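(* Let $\mathfrak{X}$ be a Banach space, let $T\colon L_1\to\mathfrak{X}$ be a bounded linear operator that is not completely continuous, and let $\{\tau_n\}_{n\ge 0}$ be a sequence of real numbers with $\tau_n>1$ for every $n$. Then there exist (A) a dyadic splitting $\mathcal{A}=\{A^n_k : n=0,1,2,\ldots,\ k=1,\ldots,2^n\}$ of some set $A^0_1\in\Sigma^+$, (B) a sequence $\{x^*_{t_n}\}_{n\ge 0}$ in $S(\mathfrak{X}^* )$, (C) for each $n\ge 0$ a finite set $\{y^*_{n,i}\}_{i=1}^{p_n}$ in $S(\mathfrak{X}^* )$, such that, for the Haar system $\{h_j\}_{j\ge 1}$ corresponding to $\mathcal{A}$, there is some $\delta>0$ so that for every $n\ge 0$: (1) $x^*_{t_n}(Th_{2^n+k})>\delta$ for $k=1,\ldots,2^n$; (2) $\{y^*_{n,i}\}_{i=1}^{p_n}$ norms $\operatorname{sp}(Th_j : 1\le j\le 2^n)$ within $\tau_n$; (3) $y^*_{n,i}(Th_{2^n+k})=0$ for $k=1,\ldots,2^n$ and $i=1,\ldots,p_n$. Moreover, if $\prod_{n\ge 0}\tau_n$ is finite, then conditions (2) and (3) guarantee that the blocking $\{\operatorname{sp}(Th_j : 2^{n-1}<j\le 2^n)\}_{n\ge 0}$ forms a finite dimensional decomposition (of its closed linear span) with constant at most $\prod_{n\ge 0}\tau_n$.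
   Context: Scalars are real. $(\Omega,\Sigma,\mu)$ is the Lebesgue measure space on $[0,1]$, $\Sigma^+$ is the collection of sets in $\Sigma$ of positive measure, and $L_1=L_1(\Omega,\Sigma,\mu)$. $\mathfrak{X}^*$ is the dual of $\mathfrak{X}$ and $S(\mathfrak{X}^* )$ is its unit sphere; $\operatorname{sp}$ denotes linear span. A bounded linear operator is completely continuous if it maps weakly convergent sequences to norm convergent sequences. A system $\mathcal{A}=\{A^n_k\in\Sigma : n=0,1,2,\ldots,\ k=1,\ldots,2^n\}$ is a dyadic splitting of $A^0_1\in\Sigma^+$ if each $A^n_k$ is partitioned into the two sets $A^{n+1}_{2k-1}$ and $A^{n+1}_{2k}$ of equal measure, for each admissible $n$ and $k$ (so $\mu(A^n_k)=2^{-n}\mu(A^0_1)$). The corresponding (normalized) Haar system $\{h_j\}_{j\ge1}$ is $$h_1=\frac{1}{\mu(A^0_1)}1_{A^0_1},\qquad h_{2^n+k}=\frac{2^n}{\mu(A^0_1)}\left(1_{A^{n+1}_{2k-1}}-1_{A^{n+1}_{2k}}\right)$$ for $n=0,1,2,\ldots$ and $k=1,\ldots,2^n$. A set $N\subset S(\mathfrak{X}^* )$ norms a subspace $\mathfrak{X}_0$ of $\mathfrak{X}$ within $\tau>1$ if for each $x\in\mathfrak{X}_0$ there is $x^*\in N$ with $\|x\|\le\tau x^*(x)$. A sequence $\{\mathfrak{X}_j\}$ of finite dimensional subspaces of $\mathfrak{X}$ (zero subspaces allowed) forms a finite dimensional decomposition of a closed subspace $\mathfrak{X}_0$ if each $x\in\mathfrak{X}_0$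 has a unique norm convergent expansion $x=\sum_j x_j$ with $x_j\in\mathfrak{X}_j$ (and each $\mathfrak{X}_j\subset\mathfrak{X}_0$); its constant is the supremum over $n$ of the norms of the partial sum projections $\sum_j x_j\mapsto\sum_{j\le n}x_j$. *)

(* Defs.v *)
From HB Require Import structures.
From mathcomp Require Import all_boot all_order all_algebra.
From mathcomp Require Import all_classical all_reals all_analysis.

Set Implicit Arguments.
Unset Strict Implicit.
Unset Printing Implicit Defensive.

Import Order.TTheory GRing.Theory Num.Theory.
Import numFieldNormedType.Exports.

Local Open Scope classical_set_scope.
Local Open Scope ring_scope.

Section unit_interval_space.
Context (R : realType).

(* The real line with the Lebesgue sigma-algebra (the Caratheodory-measurable
   sets of the outer measure, not only the Borel sets). *)
Definition lebesgue_line : measurableType _ :=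
  caratheodory_type (mu_ext (@wlength R idfun)).

Definition unit_itv : set lebesgue_line := (`[0, 1]%classic : set R).

Lemma measurable_unit_itv : measurable unit_itv.
Proof.
apply: sub_caratheodory.
exact: (@measurable_itv R `[0, 1]).
Qed.

Lemma unit_itv_lty :
  ((completed_lebesgue_measure : set lebesgue_line -> \bar R) unit_itv < +oo)%E.
Proof.
rewrite [ltLHS](_ : _ = lebesgue_measure (`[0, 1]%classic : set R)).
  by rewrite lebesgue_measure_itv /= lte_fin ltr01 -EFinB ltry.
by [].
Qed.

(* The Lebesgue measure space on [0, 1] is carried by the real line, through
   the restricted measure A |-> lambda (A `&` [0, 1]); the measurable subsets
   of [0, 1] are the elements of Sigma01. *)
Definition mu01 : {finite_measure set lebesgue_line -> \bar R} :=
  mfrestr measurable_unit_itv unit_itv_lty.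

Definition Sigma01 : set (set lebesgue_line) :=
  [set A | measurable A /\ A `<=` unit_itv].

(* The elements of L1 are functions and not classes, so that L1norm is only a
   seminorm. Linear maps bounded for L1norm agree on functions that are equal
   almost everywhere: they are exactly the bounded operators on the space of
   classes. *)
Definition L1 := LfunType mu01 (lexx 1%E).

Definition L1norm (f : L1) : R := fine ('N[mu01]_1[EFin \o f])%E.

Definition L1_bounded (V : normedModType R) (T : L1 -> V) :=
  exists M : R, forall f, `|T f| <= M * L1norm f.

Definition L1_weak_cvg (u : nat -> L1) (f : L1) :=
  forall phi : {linear L1 -> R^o}, L1_bounded phi ->
    phi (u n) @[n --> \oo] --> phi f.

Definition completely_continuous (V : normedModType R) (T : L1 -> V) :=
  forall (u : nat -> L1) (f : L1), L1_weak_cvg u f -> cvgn (T \o u).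

(* A n k stands for A^n_k and is only relevant for 1 <= k <= 2 ^ n. *)
Definition dyadic_splitting (A : nat -> nat -> set lebesgue_line) :=
  [/\ forall n k, (0 < k <= 2 ^ n)%N -> Sigma01 (A n k),
      (0 < mu01 (A 0%N 1%N))%E &
      forall n k, (0 < k <= 2 ^ n)%N ->
        [/\ A n k = A n.+1 (2 * k).-1%N `|` A n.+1 (2 * k)%N,
            A n.+1 (2 * k).-1%N `&` A n.+1 (2 * k)%N = set0 &
            mu01 (A n.+1 (2 * k).-1%N) = mu01 (A n.+1 (2 * k)%N)]].

(* h 0 is irrelevant; every other h j is determined by A. *)
Definition haar_system (A : nat -> nat -> set lebesgue_line) (h : nat -> L1) :=
  (forall x, h 1%N x = (fine (mu01 (A 0%N 1%N)))^-1 * \1_(A 0%N 1%N) x) /\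
  (forall n k, (0 < k <= 2 ^ n)%N -> forall x,
     h (2 ^ n + k)%N x = 2 ^+ n / fine (mu01 (A 0%N 1%N)) *
       (\1_(A n.+1 (2 * k).-1%N) x - \1_(A n.+1 (2 * k)%N) x)).

End unit_interval_space.

Section banach.
Context (R : realType) (X : normedModType R).
Implicit Types (Y : set X) (E : nat -> set X).

Definition opnorm_on (V : normedModType R) Y (f : X -> V) : \bar R :=
  ereal_sup [set `|f x|%:E | x in [set x | Y x /\ `|x| <= 1]].

Definition dual_sphere : set {linear X -> R^o} :=
  [set phi : {linear X -> R^o} | continuous phi /\ opnorm_on setT phi = 1%E].

Definition lin_span (S : set X) : set X :=
  [set x | exists m (c : 'I_m -> R) (s : 'I_m -> X),
     (forall i, S (s i)) /\ x = \sum_(i < m) c i *: s i].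

Definition norms_within (N : set {linear X -> R^o}) Y (tau : R) :=
  forall x, Y x -> exists2 phi : {linear X -> R^o}, N phi & `|x| <= tau * phi x.

Definition fin_dim_subspace Y := exists m (e : 'I_m -> X), Y = lin_span (range e).

Definition closed_subspace Y :=
  [/\ Y 0, forall (a : R) x y, Y x -> Y y -> Y (a *: x + y) & closed Y].

Definition fdd_expansion E (x : X) (u : nat -> X) :=
  (forall j, E j (u j)) /\ series u @ \oo --> x.

Definition is_fdd Y E :=
  [/\ closed_subspace Y,
      forall j, fin_dim_subspace (E j) /\ E j `<=` Y &
      forall x, Y x -> exists! u : nat -> X, fdd_expansion E x u].

Definition fdd_coord E (x : X) : nat -> X :=
  xget (fun=> 0) [set u | fdd_expansion E x u].

Definition fdd_proj E (n : nat) (x : X) : X := \sum_(j < n.+1) fdd_coord E x j.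

Definition fdd_constant Y E : \bar R :=
  ereal_sup (range (fun n => opnorm_on Y (fdd_proj E n))).

(* The condition 2 ^ n < 2 * j is 2 ^ (n - 1) < j, in a form that is also
   valid for n = 0, where the block is spanned by v 1. *)
Definition dyadic_block (v : nat -> X) (n : nat) : set X :=
  lin_span [set v j | j in [set j | (2 ^ n < 2 * j)%N /\ (j <= 2 ^ n)%N]].

Definition closed_lin_span (S : set X) : set X := closure (lin_span S).

End banach.

(* Main.v *)
From HB Require Import structures.
Require Import Defs.
From mathcomp Require Import all_boot all_order all_algebra.
From mathcomp Require Import all_classical all_reals all_analysis.
From mathcomp Require Import measurable_realfun ring lra.
Import Order.TTheory GRing.Theory Num.Theory.
Import numFieldNormedType.Exports HBSimple.
Local Open Scope classical_set_scope.
Local Open Scope ring_scope.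

(** Half-splittings of a set correspond to functions equal to 1 on one half
    and -1 on the other. The theorem asks for such functions, on every set of
    the current dyadic level at once, that are annihilated by finitely many
    prescribed functionals on L1 but on which one functional x* o T stays
    large. Two facts make this possible.

    The first is a form of the Lyapunov convexity theorem
    ([lyapunov_fraction], [imbalance_convex]): finitely many finitely additive
    set functions dominated by a multiple of Lebesgue measure can be scaled
    simultaneously and exactly by any t in [0, 1], by passing to a subset. It
    follows by induction on the number of set functions: repeated halving
    produces an increasing family S t on which the earlier set functions equal
    t times their value, and the intermediate value theorem along the windows
    S (t + 1/2) minus S t halves the next one.

    The second fact ([not_completely_continuous_oscillation]) uses that T is not
    completely continuous. There are a weakly null sequence g n in L1 and
    norming functionals xs n with xs n (T (g n)) >= eps. Let psi be the limit of
    the functionals xs n o T along a free ultrafilter, and let D n be the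
    bounded density of xs n o T - psi. Since psi (g n) tends to 0, the integral
    of D n * g n stays above eps / 2, and the Dunford-Pettis property of L1
    ([dunford_pettis]) keeps the integrals of |D n| away from 0. The
    ultrafilter limit of A |-> \int_A |D n| therefore has a density that exceeds
    some delta > 0 on a set B of positive measure. Thus D n tends weakly to 0
    but oscillates by at least delta on every subset of B.

    Combining the two ([exact_splitting]): given A inside B, the sign of D n
    splits A with a large imbalance for D n. The imbalances of the
    prescribed functionals converge along the ultrafilter, so averaging the sign
    of D n with the opposite of the sign of a fixed D n0 makes them small
    while keeping half of the oscillation, as D n is nearly 0 on any fixed
    function. Small errors are then removed one functional at a time, by
    mixing in a little of a fixed splitting. Prescribing Lebesgue measure, psi
    and the functionals y* o T gives equal halves, turns a large imbalance for
    D n into a large value of xs n o T, and yields the vanishing condition.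

    The norming sets come from the Hahn-Banach theorem and the compactness of
    the unit sphere in finite dimension ([fin_dim_norming]). At level n they are
    chosen to norm the span of the images of the indicators of the level-n
    sets, which contains T h_j for all j <= 2 ^ n; the recursion then depends on
    the current level only.

    For the decomposition, let v be in the span of the T h_j with j <= 2 ^ n and
    let w be in the next block. Then |v| <= tau_n y(v) = tau_n y(v + w) <=
    tau_n |v + w| for some y of the norming set. Iterating bounds every partial
    sum by the product of the tau_i times any later partial sum, and this
    bound forces existence, uniqueness and the constant of the
    decomposition ([fdd_of_projection_bound]). *)

(** * Norming functionals *)

Section hahn_banach.
Context {R : realType} (X : normedModType R).
Implicit Types G : set (X * R).

Lemma linear_bundle (V : lmodType R) (f : V -> R) :
  (forall a u v, f (a *: u + v) = a * f u + f v) ->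
  exists phi : {linear V -> R^o}, forall u, phi u = f u.
Proof.
move=> flin.
pose M := GRing.isLinear.Build R V R^o _ (f : V -> R^o) flin.
pose phi : {linear V -> R^o} := HB.pack (f : V -> R^o) M.
by exists phi.
Qed.

Lemma functional_linear (V : lmodType R) (phi : {linear V -> R^o}) a u v :
  phi (a *: u + v) = a * phi u + phi v :> R.
Proof. exact: linearP. Qed.

(** Partial functionals are handled as linear graphs in X * R; the bound by the
    norm makes such a graph single-valued. *)
Let graph_below G := (forall a p q, G p -> G q -> G (a *: p.1 + q.1, a * p.2 + q.2))
  /\ (forall p, G p -> p.2 <= `|p.1|).

Let below_scale G p a : graph_below G -> G p -> G (a *: p.1, a * p.2).
Proof.
move=> [lin _] Gp; have := lin 0 _ _ Gp Gp.
rewrite scale0r mul0r !add0r => _.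
have G0 := lin (-1) _ _ Gp Gp; have := lin a _ _ Gp G0 => /=.
by rewrite !scaleN1r !mulN1r !addNr !addr0.
Qed.

(** The admissible values c at z form the interval between the numbers
    r - |x - z| and the numbers |y + z| - s, for (x, r) and (y, s) in the
    graph; it is nonempty by the triangle inequality. *)
Lemma graph_extension G (z : X) : graph_below G -> G !=set0 ->
  exists c, graph_below
    [set q | exists2 p, G p & exists a, q = (p.1 + a *: z, p.2 + a * c)].
Proof.
move=> gbG; have [lin dom] := gbG => -[p0 Gp0].
have cross p q : G p -> G q -> p.2 - `|p.1 - z| <= `|q.1 + z| - q.2.
  move=> Gp Gq; have := dom _ (lin 1 _ _ Gp Gq) => /=.
  rewrite scale1r mul1r => h.
  have := ler_normD (p.1 - z) (q.1 + z).
  rewrite addrACA addNr addr0; lra.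
pose L := [set p.2 - `|p.1 - z| | p in G].
have L0 : L !=set0 by exists (p0.2 - `|p0.1 - z|), p0.
have Lub : has_ubound L.
  by exists (`|p0.1 + z| - p0.2) => _ [p Gp <-]; exact: cross.
exists (sup L); split.
  move=> a _ _ [p Gp [b ->]] [q Gq [b' ->]] /=.
  exists (a *: p.1 + q.1, a * p.2 + q.2); first exact: lin.
  exists (a * b + b'); congr pair => /=.
    by rewrite scalerDr scalerDl scalerA addrACA.
  ring.
have low p : G p -> p.2 - `|p.1 - z| <= sup L.
  by move=> Gp; apply: ub_le_sup => //; exists p.
have high q : G q -> sup L <= `|q.1 + z| - q.2.
  by move=> Gq; apply: ge_sup => // _ [p Gp <-]; exact: cross.
move=> _ [p Gp [a ->]] /=.
have [a0|a0|->] := ltgtP a 0; last by rewrite scale0r mul0r !addr0; exact: dom.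
- have a1 : 0 < - a by rewrite oppr_gt0.
  have := low _ (below_scale _ _ (- a)^-1 gbG Gp) => /=.
  rewrite -(ler_pM2l a1) mulrBr mulrA divff ?gt_eqF// mul1r.
  rewrite -{1}(gtr0_norm a1) -normrZ scalerBr scalerA divff ?gt_eqF//.
  rewrite scale1r scaleNr opprK; lra.
- have := high _ (below_scale _ _ a^-1 gbG Gp) => /=.
  rewrite -(ler_pM2l a0) mulrBr mulrA divff ?gt_eqF// mul1r.
  rewrite -{2}(gtr0_norm a0) -normrZ scalerDr scalerA divff ?gt_eqF//.
  rewrite scale1r; lra.
Qed.

(** Zorn's lemma also considers the empty chain, whose union is the empty graph;
    the prescribed value at x0 is therefore only required of nonempty graphs. *)
Lemma norming_functional (x0 : X) : exists phi : {linear X -> R^o},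
  (forall x, phi x <= `|x|) /\ phi x0 = `|x0|.
Proof.
pose P G := graph_below G /\ (G !=set0 -> G (x0, `|x0|)).
have [G [[gbG G0] Gmax]] : exists G, P G /\ forall B, G `<` B -> ~ P B.
  apply: Zorn_bigcup => F FP Ftot; split; last first.
    by move=> [p [B FB Bp]]; exists B => //; apply: (FP _ FB).2; exists p.
  split; last by move=> p [B FB Bp]; exact: (FP _ FB).1.2.
  move=> a p q [B FB Bp] [C FC Cq].
  have [BC|CB] := Ftot _ _ FB FC.
    by exists C => //; apply: (FP _ FC).1.1 => //; exact: BC.
  by exists B => //; apply: (FP _ FB).1.1 => //; exact: CB.
have Gn0 : G !=set0.
  apply: contrapT => /set0P/negP; rewrite negbK => /eqP Ge.
  pose G1 := [set q : X * R | exists a, q = (a *: x0, a * `|x0|)].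
  have G1x : G1 (x0, `|x0|) by exists 1; rewrite scale1r mul1r.
  apply: (Gmax G1).
    by rewrite Ge; split=> // /(_ _ G1x).
  split=> //; split.
    move=> a _ _ [b ->] [c ->]; exists (a * b + c) => /=.
    by rewrite scalerDl mulrDl -mulrA scalerA.
  by move=> _ [a ->] /=; rewrite normrZ ler_wpM2r// ler_norm.
have full z : exists r, G (z, r).
  have [c gbG'] := graph_extension _ z gbG Gn0.
  set G' := (X in graph_below X) in gbG'.
  have GG' : G `<=` G'.
    by move=> p Gp; exists p => //; exists 0; rewrite scale0r mul0r !addr0 -surjective_pairing.
  have [G'G|nG'G] := pselect (G' `<=` G); last first.
    exfalso; apply: (Gmax G') => //; split=> // _.
    exact/GG'/G0.
  exists (0 + 1 * c); apply: G'G; have [p Gp] := Gn0.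
  exists (0 *: p.1, 0 * p.2); first exact: (below_scale _ _ 0 gbG Gp).
  by exists 1; rewrite /= !scale0r !mul0r scale1r !add0r.
have uniq z r s : G (z, r) -> G (z, s) -> r = s.
  move=> Gr Gs; apply/eqP; rewrite eq_le; apply/andP; split.
    have := gbG.2 _ (gbG.1 (-1) _ _ Gs Gr) => /=.
    by rewrite scaleN1r addNr normr0; lra.
  have := gbG.2 _ (gbG.1 (-1) _ _ Gr Gs) => /=.
  by rewrite scaleN1r addNr normr0; lra.
pose f z := sval (cid (full z)).
have Gf z : G (z, f z) by rewrite /f; case: cid.
have [phi phiE] := linear_bundle X f (fun a u v =>
  uniq _ _ _ (Gf (a *: u + v)) (gbG.1 a _ _ (Gf u) (Gf v))).
exists phi; split; first by move=> x; rewrite phiE; exact: (gbG.2 _ (Gf x)).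
by rewrite phiE; apply: (uniq x0); [exact: Gf|exact: G0].
Qed.

Lemma le_norm_functional (phi : {linear X -> R^o}) :
  (forall x, phi x <= `|x|) -> forall x, `|phi x| <= `|x|.
Proof.
move=> h x; rewrite ler_norml h andbT.
by have := h (- x); rewrite linearN normrN /=; lra.
Qed.

Lemma dual_sphere_le (phi : {linear X -> R^o}) :
  dual_sphere phi -> forall x, `|phi x| <= `|x|.
Proof.
move=> [_ phi1] x.
have [->|x0] := eqVneq x 0; first by rewrite linear0 !normr0.
have nx0 : 0 < `|x| by rewrite normr_gt0.
have : ((`|phi (`|x|^-1 *: x)|)%:E <= 1)%E.
  rewrite -phi1; apply: ereal_sup_ubound; exists (`|x|^-1 *: x) => //; split=> //.
  by rewrite normrZ normfV normr_id mulVf// gt_eqF.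
rewrite lee_fin linearZ normrZ normfV normr_id mulrC.
by rewrite ler_pdivrMr// mul1r.
Qed.

Lemma dual_sphere_intro (phi : {linear X -> R^o}) (x0 : X) : x0 != 0 ->
  (forall x, phi x <= `|x|) -> phi x0 = `|x0| -> dual_sphere phi.
Proof.
move=> x00 phile phix0; have phin := le_norm_functional _ phile.
have nx0 : 0 < `|x0| by rewrite normr_gt0.
split.
  have : bounded_near phi (nbhs (0 : X)).
    rewrite /bounded_near; near=> M; near=> x.
    apply: (le_trans (phin _)).
    apply: (@le_trans _ _ 1).
      near: x; apply/nbhs_normP; exists 1 => //= y /=.
      by rewrite sub0r normrN => /ltW.
    by near: M; exact: nbhs_pinfty_ge.
  by move/linear_bounded_continuous.
apply/eqP; rewrite eq_le; apply/andP; split.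
  apply: ge_ereal_sup => _ [x [_ x1] <-]; rewrite lee_fin.
  exact: le_trans (phin x) x1.
apply: ereal_sup_ubound; exists (`|x0|^-1 *: x0).
  by split=> //; rewrite normrZ normfV normr_id mulVf// gt_eqF.
by rewrite linearZ/= phix0 normrM normfV !normr_id mulVf// gt_eqF.
Unshelve. all: by end_near. Qed.

Lemma dual_sphere_norming (x0 : X) : x0 != 0 ->
  exists2 phi : {linear X -> R^o}, dual_sphere phi & phi x0 = `|x0|.
Proof.
move=> x00; have [phi [phile phix0]] := norming_functional x0.
by exists phi => //; exact: dual_sphere_intro x00 _ _.
Qed.

End hahn_banach.

(** * Finite dimensional subspaces *)

Section finite_dimension.
Context {R : realType} (X : normedModType R).
Implicit Types (F : set X) (S : set X).

Lemma lin_span_sub S F : (forall a x y, F x -> F y -> F (a *: x + y)) -> F 0 ->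
  S `<=` F -> lin_span S `<=` F.
Proof.
move=> lin F0 SF _ [m [c [s [sS ->]]]].
by elim/big_ind : _ => // [x y Fx Fy|i _]; [rewrite -[x]scale1r|rewrite -[_ *: _]addr0];
  apply: lin => //; apply: SF.
Qed.

Lemma lin_span0 S : lin_span S 0.
Proof.
exists 0%N, (fun=> 0), (fun=> 0); split; first by case.
by rewrite big_ord0.
Qed.

Lemma lin_span_gen S : S `<=` lin_span S.
Proof.
move=> x Sx; exists 1%N, (fun=> 1), (fun=> x); split => //.
by rewrite big_ord1 scale1r.
Qed.

Lemma lin_span_linear S a x y :
  lin_span S x -> lin_span S y -> lin_span S (a *: x + y).
Proof.
move=> [m [c [s [sS ->]]]] [n [d [t [tS ->]]]].
exists (m + n)%N,
  (fun i : 'I_(m + n) =>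
     match fintype.split i with inl j => a * c j | inr k => d k end),
  (fun i : 'I_(m + n) =>
     match fintype.split i with inl j => s j | inr k => t k end); split.
  by move=> i; case: splitP.
rewrite big_split_ord /= scaler_sumr; congr +%R.
  by apply: eq_bigr => i _; rewrite (unsplitK (inl _ i)) scalerA.
by apply: eq_bigr => i _; rewrite (unsplitK (inr _ i)).
Qed.

Lemma lin_spanZ S a x : lin_span S x -> lin_span S (a *: x).
Proof. by move=> Sx; rewrite -[_ *: _]addr0; apply: lin_span_linear => //; exact: lin_span0. Qed.

Lemma lin_spanD S x y : lin_span S x -> lin_span S y -> lin_span S (x + y).
Proof. by move=> Sx Sy; rewrite -[x]scale1r; exact: lin_span_linear. Qed.

Lemma lin_span_sum S I (r : seq I) (P : pred I) (f : I -> X) :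
  (forall i, P i -> lin_span S (f i)) -> lin_span S (\sum_(i <- r | P i) f i).
Proof.
move=> Sf; elim/big_ind : _ => //; first exact: lin_span0.
by move=> x y; exact: lin_spanD.
Qed.

Lemma lin_span_mono S S' : S `<=` lin_span S' -> lin_span S `<=` lin_span S'.
Proof.
apply: lin_span_sub; last exact: lin_span0.
by move=> a x y; exact: lin_span_linear.
Qed.

(** Compactness of all balls of F, which is stable under adding one vector and
    yields closedness. *)
Definition proper_balls F := forall r, compact (F `&` [set x | `|x| <= r]).

Lemma closed_norm_le r : closed [set x : X | `|x| <= r].
Proof.
apply: (@preimage_closed _ _ (fun x : X => `|x|) [set y : R | y <= r]).
  by move=> x _; exact: norm_continuous.
exact: closed_le.
Qed.

Lemma proper_balls_closed F : proper_balls F -> closed F.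
Proof.
move=> pF x clx; pose K := F `&` [set y | `|y| <= `|x| + 1].
have clK : closed K by apply: compact_closed => //; exact: pF.
suff : K x by case.
apply: clK => B nB.
have [y [Fy [By bxy]]] := clx _ (filterI nB (@nbhsx_ballx _ _ x 1 ltr01)).
exists y; split=> //; split=> //=.
have := ler_normB x (x - y); rewrite opprB addrC subrK.
by move: bxy; rewrite -ball_normE/=; lra.
Qed.

(** When e is outside the closed set F, it is at a distance d > 0 from F, so
    that |a| d <= |x + a e| for x in F. Bounded vectors of F + R e thus have
    bounded components, and their set is a closed part of the continuous
    image of a compact product. *)
Lemma proper_balls_add F (e : X) :
  (forall a x y, F x -> F y -> F (a *: x + y)) -> proper_balls F ->
  proper_balls [set x + a *: e | x in F & a in setT].
Proof.
move=> lin pF; have clF := proper_balls_closed F pF.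
have scal a x : F x -> F (a *: x).
  move=> Fx; have := lin (a - 1) _ _ Fx Fx.
  by rewrite -[X in _ + X]scale1r -scalerDl subrK.
set G := [set _ | _ in _ & _ in _].
have [Fe|nFe] := pselect (F e).
  suff -> : G = F by [].
  rewrite predeqE => x; split; first by move=> [y Fy [a _ <-]]; rewrite addrC; exact: lin.
  by move=> Fx; exists x => //; exists 0 => //; rewrite scale0r addr0.
have [d d0 dF] : exists2 d : R, 0 < d & forall f, F f -> d <= `|e - f|.
  have /nbhs_normP[d /= d0 dF] : nbhs e (~` F).
    by apply: open_nbhs_nbhs; split => //; exact: closed_openC.
  by exists d => // f Ff; rewrite leNgt; apply/negP => /dF.
have coef f a : F f -> `|a| * d <= `|f + a *: e|.
  move=> Ff; have [->|a0] := eqVneq a 0; first by rewrite normr0 mul0r.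
  have -> : f + a *: e = a *: (e - (- a^-1) *: f).
    by rewrite scalerBr scalerA mulrN divff// scaleN1r opprK addrC.
  by rewrite normrZ ler_wpM2l//; apply/dF/scal.
move=> r.
pose K := (F `&` [set x | `|x| <= r + r / d * `|e|]) `*` `[- (r / d), r / d]%classic.
pose h (p : X * R^o) := p.1 + p.2 *: e.
have cK : compact (h @` K).
  apply: continuous_compact; last first.
    by apply: compact_setX; [exact: pF|exact: segment_compact].
  apply: continuous_subspaceT => p; apply: cvgD; first exact: cvg_fst.
  by apply: cvgZr_tmp; exact: cvg_snd.
have -> : G `&` [set x | `|x| <= r] = (h @` K) `&` [set x | `|x| <= r].
  rewrite predeqE => x; split=> -[]; last first.
    by move=> [[y a] /= [[Fy _] _] <-] xr; split=> //; exists y => //; exists a.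
  move=> [y Fy [a _ <-]] /= xr; split=> //; exists (y, a) => //=.
  have ar : `|a| <= r / d.
    by rewrite ler_pdivlMr//; apply: le_trans xr; exact: coef.
  split; last by rewrite set_itvcc /= -ler_norml.
  split=> //=; have := ler_normB (y + a *: e) (a *: e); rewrite addrK normrZ.
  have : `|a| * `|e| <= r / d * `|e| by rewrite ler_wpM2r.
  lra.
by apply: compact_closedI => //; exact: closed_norm_le.
Qed.

Lemma lin_span_proper_balls m (e : 'I_m -> X) : proper_balls (lin_span (range e)).
Proof.
elim: m e => [|m IH] e.
  move=> r; have sub : lin_span (range e) `&` [set x | `|x| <= r] `<=` [set 0].
    by move=> x [[n [c [s [sS ->]]]] _] /=; rewrite big1// => i _; have [[]] := sS i.
  have [->|->] := subset_set1 sub; first exact: compact0.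
  exact: compact_set1.
pose e' i := e (widen_ord (leqnSn m) i).
suff -> : lin_span (range e) =
    [set x + a *: e ord_max | x in lin_span (range e') & a in setT].
  by apply: proper_balls_add; [move=> a x y; exact: lin_span_linear|exact: IH].
rewrite predeqE => x; split; last first.
  move=> [y Sy [a _ <-]]; apply: lin_spanD; last first.
    by apply/lin_spanZ/lin_span_gen; exists ord_max.
  move: y Sy; apply: lin_span_mono => _ [i _ <-]; apply: lin_span_gen.
  by exists (widen_ord (leqnSn m) i).
move: x; apply: lin_span_sub.
- move=> a _ _ [y Sy [b _ <-]] [z Sz [c _ <-]].
  exists (a *: y + z); first exact: lin_span_linear.
  by exists (a * b + c) => //; rewrite scalerDr scalerA scalerDl addrACA.
- by exists 0; [exact: lin_span0|exists 0 => //; rewrite scale0r addr0].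
- move=> _ [i _ <-]; have [j ->|->] := unliftP ord_max i; last first.
    by exists 0; [exact: lin_span0|exists 1 => //; rewrite scale1r add0r].
  exists (e' j); first by apply: lin_span_gen; exists j.
  exists 0 => //; rewrite scale0r addr0 /e'; congr e; apply: val_inj => /=.
  by rewrite /bump leqNgt ltn_ord add0n.
Qed.

Lemma fin_dim_closed F : fin_dim_subspace F -> closed F.
Proof.
by move=> [m [e ->]]; apply: proper_balls_closed; exact: lin_span_proper_balls.
Qed.

(** The open sets where tau * phi > 1, for phi norming a point of the unit sphere
    of F, cover this compact sphere. The point x0 only witnesses that X is not
    the zero space, so that the finite set can be taken nonempty: it has to
    norm the zero vector too. *)
Lemma fin_dim_norming F (tau : R) (x0 : X) : x0 != 0 -> 1 < tau ->
  fin_dim_subspace F -> exists p (y : 'I_p -> {linear X -> R^o}),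
    (forall i, dual_sphere (y i)) /\ norms_within (range y) F tau.
Proof.
move=> x00 tau1 [m [e ->]]; set S := lin_span _.
have [phi0 sphi0 phi0x] := dual_sphere_norming _ _ x00.
have /choice[phi phiP] : forall v : X, exists phi : {linear X -> R^o},
    dual_sphere phi /\ (v != 0 -> phi v = `|v|).
  move=> v; have [->|v0] := eqVneq v 0; first by exists phi0.
  by have [phi] := dual_sphere_norming _ _ v0; exists phi.
pose K := (S `&` [set x | `|x| <= 1]) `&` [set x | `|x| = 1].
have cK : compact K.
  apply: compact_closedI; first exact: lin_span_proper_balls.
  apply: (@preimage_closed _ _ (fun x : X => `|x|) [set y : R | y = 1]).
    by move=> x _; exact: norm_continuous.
  exact: closed_eq.
pose O v := [set x : X | 1 < tau * phi v x].
have [D DK KD] : finite_subset_cover K O K.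
  move: cK; rewrite compact_cover; apply.
    move=> v _; apply: (@open_comp _ _ (fun x => tau * phi v x) [set y : R | 1 < y]).
      move=> x _; apply: cvgM; first exact: cvg_cst.
      exact: (phiP v).1.1.
    exact: open_gt.
  move=> v Kv; exists v => //; rewrite /O/= (phiP v).2; last first.
    apply/eqP => v0; move: Kv => [_] /=; rewrite v0 normr0 => /eqP.
    by rewrite eq_sym oner_eq0.
  by rewrite Kv.2 mulr1.
pose L := phi0 :: [seq phi v | v <- finmap.enum_fset D].
exists (size L), (fun i => nth phi0 L i); split.
  move=> [[|i] iL] //=; rewrite (nth_map 0); first exact: (phiP _).1.
  by move: iL; rewrite /= size_map.
move=> x Sx; have [->|xn0] := eqVneq x 0.
  by exists phi0; [exists ord0|rewrite normr0 linear0 mulr0].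
have nx : 0 < `|x| by rewrite normr_gt0.
have [|v /= vD Ov] := KD (`|x|^-1 *: x).
  by split; [split; [exact: lin_spanZ|]|]; rewrite /= normrZ normfV normr_id mulVf ?gt_eqF.
have iD : ((index v (finmap.enum_fset D)).+1 < size L)%N.
  by rewrite /= size_map ltnS index_mem.
exists (phi v).
  exists (Ordinal iD) => //=.
  by rewrite (nth_map 0) ?nth_index// index_mem.
move: Ov; rewrite /O/= linearZ/= mulrCA mulrC ltr_pdivlMr// mul1r; exact: ltW.
Qed.

End finite_dimension.

(** * Decompositions from bounded partial sums *)

Section finite_dimensional_decomposition.
Context {R : realType} (X : completeNormedModType R).
Implicit Types (S : set X) (E : nat -> set X).

Lemma closure_normP S x :
  closure S x <-> forall e : R, 0 < e -> exists2 s, S s & `|x - s| < e.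
Proof.
split=> [clx e e0|h B /nbhs_normP[e /= e0 eB]].
  by have [s [Ss]] := clx _ (nbhsx_ballx x e e0); rewrite -ball_normE; exists s.
by have [s Ss xs] := h _ e0; exists s; split=> //; exact: eB.
Qed.

Lemma closed_lin_span_subspace S : closed_subspace (closed_lin_span S).
Proof.
split; [exact/subset_closure/lin_span0| |exact: closed_closure].
move=> a x y /closure_normP Sx /closure_normP Sy; apply/closure_normP => e e0.
have a1 : 0 < `|a| + 1 by rewrite ltr_wpDl.
have [s Ss xs] := Sx (e / 2 / (`|a| + 1)) ltac:(by rewrite !divr_gt0).
have [t St yt] := Sy (e / 2) ltac:(by rewrite divr_gt0).
exists (a *: s + t); first exact: lin_span_linear.
rewrite opprD addrACA -scalerBr; apply: le_lt_trans (ler_normD _ _) _.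
rewrite normrZ [ltRHS](splitr e) ler_ltD//.
move: xs; rewrite ltr_pdivlMr// => xs.
have := normr_ge0 (x - s); nra.
Qed.

Lemma series_linear (e e' : nat -> X) a n :
  series (fun j => a *: e j + e' j) n = a *: series e n + series e' n.
Proof. by rewrite /series /= big_split /= scaler_sumr. Qed.

(** The data of a Schauder decomposition: finite dimensional pieces whose finite
    sums satisfy a uniform bound for initial partial sums. *)

Section projection_bound.
Variables (E : nat -> set X) (K : R).
Hypothesis K1 : 1 <= K.
Hypothesis Efin : forall j, fin_dim_subspace (E j).
Hypothesis Ebound : forall e, (forall j, E j (e j)) ->
  forall n m, (n <= m)%N -> `|series e n| <= K * `|series e m|.
Let Y := closed_lin_span (\bigcup_n E n).

Let E_lin j a x y : E j x -> E j y -> E j (a *: x + y).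
Proof. by have [m [e ->]] := Efin j; exact: lin_span_linear. Qed.

Let E0 j : E j 0.
Proof. by have [m [e ->]] := Efin j; exact: lin_span0. Qed.

Let span_expansion x : lin_span (\bigcup_n E n) x ->
  exists e, (forall j, E j (e j)) /\ exists N, forall n, (N <= n)%N -> series e n = x.
Proof.
pose F := [set x : X | exists e : nat -> X, (forall j, E j (e j)) /\
  exists N, forall n, (N <= n)%N -> series e n = x].
suff : lin_span (\bigcup_n E n) `<=` F by apply.
apply: lin_span_sub.
- move=> a y z [e [Ee [N eN]]] [e' [Ee' [N' eN']]].
  exists (fun j => a *: e j + e' j); split; first by move=> j; exact: E_lin.
  exists (maxn N N') => n; rewrite geq_max => /andP[Nn N'n].
  by rewrite series_linear eN// eN'.
- exists (fun=> 0); split => //; exists 0%N => n _.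
  by rewrite /series /= big1.
- move=> y [i _ Ey]; exists (fun j => if j == i then y else 0); split.
    by move=> j; case: eqP => [->|_].
  exists i.+1 => n ni; rewrite /series /= -big_mkcond/= big_nat1_eq.
  by rewrite ni.
Qed.

Let expansion_bound x u : fdd_expansion E x u ->
  forall n, `|series u n| <= K * `|x|.
Proof.
move=> [Eu ux] n.
have : (fun m => K * `|series u m|) @ \oo --> K * `|x|.
  by apply: cvgM; [exact: cvg_cst|exact: cvg_norm].
move=> /cvg_lim <- //; apply: limr_ge.
  by apply: is_cvgM; [exact: is_cvg_cst|apply: is_cvg_norm; apply/cvg_ex; exists x].
by exists n => // m /= nm; exact: Ebound.
Qed.

Let expansion_uniq x u v : fdd_expansion E x u -> fdd_expansion E x v -> u = v.
Proof.
move=> [Eu ux] [Ev vx].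
have ser n : series (fun j => -1 *: v j + u j) n = 0.
  have := @expansion_bound 0 (fun j => -1 *: v j + u j).
  move=> /(_ _ n); rewrite normr0 mulr0 normr_le0 => h; apply/eqP/h; split.
    by move=> j; exact: E_lin.
  rewrite (_ : series _ = fun n => - series v n + series u n); last first.
    by apply/funext => m; rewrite series_linear scaleN1r.
  by rewrite -(addNr x); apply: cvgD => //; exact: cvgN.
apply/funext => j; have := ser j.+1; rewrite /series /= big_nat_recr //=.
have := ser j; rewrite /series /= => ->.
by rewrite add0r scaleN1r addrC => /subr0_eq.
Qed.

(** The coordinates of approximating finite sums are Cauchy, uniformly in the
    order n of the partial sum, so the limit of the coordinates expands x. *)
Let expansion_exists x : Y x -> exists u, fdd_expansion E x u.
Proof.
move=> /closure_normP Yx.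
pose r k : R := k.+1%:R^-1.
have r0 k : 0 < r k by rewrite invr_gt0.
have rdec k l : (k <= l)%N -> r l <= r k.
  by move=> kl; rewrite lef_pV2 ?posrE// ler_nat.
have /choice[e eP] : forall k, exists e : nat -> X, (forall j, E j (e j)) /\
    exists s, `|x - s| < r k /\ exists N, forall n, (N <= n)%N -> series e n = s.
  move=> k; have [s /span_expansion[e [Ee eN]] xs] := Yx _ (r0 k).
  by exists e; split => //; exists s.
have close k l n : (k <= l)%N -> `|series (e k) n - series (e l) n| <= 2 * K * r k.
  move=> kl; have [Ek [s [xs [N sN]]]] := eP k; have [El [t [xt [M tM]]]] := eP l.
  have Ekl j : E j (-1 *: e l j + e k j) by exact: E_lin.
  have := Ebound _ Ekl n (maxn n (maxn N M)) (leq_maxl _ _).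
  rewrite !series_linear !scaleN1r (sN (maxn n _)) ?leq_max ?leqnn ?orbT//.
  rewrite (tM (maxn n _)) ?leq_max ?leqnn ?orbT//.
  rewrite [in X in X -> _]addrC => /le_trans; apply.
  rewrite -mulrA mulrCA ler_wpM2l ?(le_trans _ K1)//.
  have -> : - t + s = (x - t) - (x - s) by rewrite opprB [RHS]addrC [RHS]addrA subrK addrC.
  apply: le_trans (ler_normB _ _) _; have := rdec _ _ kl; lra.
have closej k l j : (k <= l)%N -> `|e k j - e l j| <= 4 * K * r k.
  move=> kl; have := close k l j kl; have := close k l j.+1 kl.
  rewrite /series /= !big_nat_recr //=.
  set a := \sum_(_ <= _ < _) _; set b := \sum_(_ <= _ < _) _ => h1 h2.
  have -> : e k j - e l j = (a + e k j - (b + e l j)) - (a - b).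
    by rewrite (opprD b) (addrACA a) [X in _ = X - _]addrC addrK.
  by apply: le_trans (ler_normB _ _) _; lra.
have small c : 0 < c -> exists k, 4 * K * r k < c.
  move=> c0; have K4 : 0 < 4 * K by rewrite mulr_gt0// (lt_le_trans _ K1).
  have [k] := ltr_add_invr (y := 0) (x := c / (4 * K)) ltac:(by rewrite divr_gt0).
  by rewrite add0r ltr_pdivlMr// mulrC => h; exists k.
have ecvg j : cvg ((fun k => e k j) @ \oo).
  apply/cauchy_cvgP/cauchy_exP => c c0; have [k kc] := small _ c0.
  exists (e k j); exists k => // l /= kl; rewrite -ball_normE /=.
  exact: le_lt_trans (closej _ _ _ kl) kc.
pose u j := lim ((fun k => e k j) @ \oo).
have serlim n : (fun k => series (e k) n) @ \oo --> series u n.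
  by rewrite /series /=; apply: cvg_big => [|j _]; [exact: add_continuous|exact: ecvg].
have closeu k n : `|series (e k) n - series u n| <= 2 * K * r k.
  have : (fun l => `|series (e k) n - series (e l) n|) @ \oo -->
      `|series (e k) n - series u n|.
    by apply: cvg_norm; apply: cvgB; [exact: cvg_cst|exact: serlim].
  move=> h; rewrite -(cvg_lim _ h)//; apply: limr_le.
    by apply/cvg_ex; eexists; exact: h.
  by exists k => // l /= kl; exact: close.
exists u; split.
  move=> j; apply: (closed_cvg (fun y => E j y)) (ecvg j).
    exact: fin_dim_closed.
  by apply: nearW => k; exact: (eP k).1.
apply/cvgrPdist_lt => c c0; have [k kc] := small _ c0.
have [_ [s [xs [N sN]]]] := eP k.
exists N => // n /= Nn; have := closeu k n; rewrite (sN _ Nn) => su.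
have -> : x - series u n = (x - s) + (s - series u n) by rewrite addrA subrK.
apply: le_lt_trans (ler_normD _ _) _; apply: lt_trans kc.
  have : r k <= K * r k by rewrite ler_peMl// ltW.
  have := r0 k; lra.
Qed.

Lemma fdd_of_projection_bound : is_fdd Y E /\ (fdd_constant Y E <= K%:E)%E.
Proof.
split.
  split; first exact: closed_lin_span_subspace.
    move=> j; split=> // x Ex; apply/subset_closure/lin_span_gen.
    by exists j.
  move=> x /expansion_exists[u xu]; exists u; split=> // v.
  exact: expansion_uniq.
apply: ge_ereal_sup => _ [n _ <-]; apply: ge_ereal_sup => _ [x [Yx x1] <-].
have [u xu] := expansion_exists _ Yx.
have -> : fdd_proj E n x = series u n.+1.
  rewrite /fdd_proj /series /= big_mkord; apply: eq_bigr => j _.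
  have := @xgetPex _ (fun=> 0) [set u | fdd_expansion E x u] (ex_intro _ u xu).
  by rewrite -/(fdd_coord E x) => /expansion_uniq/(_ xu) ->.
rewrite lee_fin; apply: le_trans (expansion_bound _ _ xu _) _.
by rewrite -[leRHS]mulr1 ler_wpM2l// (le_trans _ K1).
Qed.

End projection_bound.

Lemma dyadic_block_fin_dim (v : nat -> X) n : fin_dim_subspace (dyadic_block v n).
Proof.
rewrite /dyadic_block; set D := [set j | _].
have [m [e eD]] : exists m (e : 'I_m -> X), [set v j | j in D] = range e.
  pose s := [seq j <- iota 0 (2 ^ n).+1 | (2 ^ n < 2 * j)%N].
  exists (size s), (fun i => v (nth 0%N s i)); rewrite predeqE => x; split.
    move=> [j [j1 j2] <-].
    have js : j \in s by rewrite mem_filter j1 mem_iota add0n ltnS.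
    have si : (index j s < size s)%N by rewrite index_mem.
    by exists (Ordinal si) => //=; rewrite nth_index.
  move=> [i _ <-]; exists (nth 0%N s i) => //.
  have : nth 0%N s i \in s by exact: mem_nth.
  by rewrite mem_filter mem_iota add0n ltnS => /andP[].
by exists m, e; rewrite eD.
Qed.

(** The functionals norming the span of the blocks 0, ..., n vanish on the block
    n + 1, so adding a vector of this block divides the norm by at most
    tau n. *)
Lemma norming_blocks_fdd (v : nat -> X) (tau : nat -> R) (p : nat -> nat)
    (y : forall n, 'I_(p n) -> {linear X -> R^o}) :
  (forall n, 1 < tau n) -> cvgn (fun N => \prod_(0 <= n < N) tau n) ->
  (forall n (i : 'I_(p n)), dual_sphere (y n i)) ->
  (forall n, norms_within (range (y n))
     (lin_span [set v j | j in [set j | (0 < j <= 2 ^ n)%N]]) (tau n)) ->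
  (forall n k (i : 'I_(p n)), (0 < k <= 2 ^ n)%N -> y n i (v (2 ^ n + k)%N) = 0) ->
  let E := dyadic_block v in
  let Y := closed_lin_span (\bigcup_n E n) in
  is_fdd Y E /\
  (fdd_constant Y E <= (limn (fun N => \prod_(0 <= n < N) tau n))%:E)%E.
Proof.
move=> tau1 cvtau ysph ynorm yvan E Y.
pose S n := lin_span [set v j | j in [set j | (0 < j <= 2 ^ n)%N]].
have prod_nd m n : (m <= n)%N -> \prod_(0 <= i < m) tau i <= \prod_(0 <= i < n) tau i.
  move=> mn; rewrite [leRHS](@big_cat_nat _ _ _ m)//= -[leLHS]mulr1 ler_wpM2l//.
    by apply: prodr_ge0 => i _; rewrite ltW// (lt_trans ltr01).
  by elim/big_ind : _ => // [a b|i _]; [exact: mulr_ege1|exact: ltW].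
have prod_lim n : \prod_(0 <= i < n) tau i <= limn (fun N => \prod_(0 <= n < N) tau n).
  apply: limr_ge => //; exists n => // m /= nm; exact: prod_nd.
have block_vanish n (i : 'I_(p n)) : E n.+1 `<=` [set x | y n i x = 0].
  apply: lin_span_sub => /=.
  - by move=> a x z yx yz; rewrite linearP yx yz /= scaler0 addr0.
  - by rewrite linear0.
  - move=> _ [j [j1 j2] <-] /=; rewrite expnS ltn_pmul2l// in j1.
    rewrite -(subnKC (ltnW j1)) yvan// subn_gt0 j1/= leq_subLR addnn -mul2n.
    by rewrite -expnS.
have block_sub n m : (n <= m)%N -> E n `<=` S m.
  move=> nm; apply: lin_span_mono => _ [j [j1 j2] <-]; apply: lin_span_gen.
  exists j => //=; rewrite (leq_trans j2) ?leq_exp2l// andbT.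
  by case: j j1 {j2} => //; rewrite muln0.
have step e n : (forall j, E j (e j)) ->
    `|series e n.+1| <= tau n * `|series e n.+2|.
  move=> Ee; have Sn : S n (series e n.+1).
    rewrite /series /= big_nat; apply: lin_span_sum => j /= jn.
    exact: (block_sub j n) (Ee j).
  have [_ [i _ <-] le1] := ynorm n _ Sn; apply: le_trans le1 _.
  rewrite ler_wpM2l ?(ltW (lt_trans ltr01 (tau1 n)))//.
  rewrite (le_trans _ (dual_sphere_le _ _ (ysph n i) _))//.
  rewrite {2}/series /= big_nat_recr //= linearD.
  have -> : y n i (e n.+1) = 0 by exact: (block_vanish n i).
  by rewrite addr0 ler_norm.
apply: fdd_of_projection_bound.
- by have := prod_lim 0%N; rewrite big_nil.
- exact: dyadic_block_fin_dim.
- move=> e Ee n m nm; have [->|n0] := posnP n.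
    rewrite /series /= big_nil normr0 mulr_ge0//.
    by apply: le_trans (prod_lim 0%N); rewrite big_nil.
  case: n n0 nm => // n _; case: m => // m; rewrite ltnS => nm.
  apply: (@le_trans _ _ (\prod_(n <= i < m) tau i * `|series e m.+1|)).
    elim: m nm => [|m IH]; first by rewrite leqn0 => /eqP ->; rewrite big_nil mul1r.
    rewrite leq_eqVlt => /predU1P[->|]; first by rewrite big_geq// mul1r.
    rewrite ltnS => nm; apply: le_trans (IH nm) _; rewrite big_nat_recr//= -mulrA.
    rewrite ler_wpM2l ?step//; apply: prodr_ge0 => i _.
    by rewrite ltW// (lt_trans ltr01).
  rewrite ler_wpM2r//; apply: le_trans (prod_lim m).
  rewrite [leRHS](@big_cat_nat _ _ _ n)//= -[leLHS]mul1r ler_wpM2r//.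
    by apply: prodr_ge0 => i _; rewrite ltW// (lt_trans ltr01).
  by have := prod_nd 0%N n (leq0n _); rewrite big_nil.
Qed.

End finite_dimensional_decomposition.

(** * Lyapunov convexity for dominated set functions *)

Section nonatomic.
Context {R : realType}.
Local Notation Om := (lebesgue_line R).
Local Notation mu := (mu01 R).
Implicit Types (A B : set Om) (m : set Om -> R).

Definition vol A : R := fine (mu A).

Lemma mu01E A : mu A =
  (completed_lebesgue_measure : set Om -> \bar R) (A `&` @unit_itv R).
Proof. by []. Qed.

Lemma volE A : measurable A -> (vol A)%:E = mu A.
Proof. by move=> mA; rewrite /vol fineK// fin_num_measure. Qed.

Lemma vol_ge0 A : 0 <= vol A.
Proof. exact: fine_ge0. Qed.

(** Countable additivity is a consequence of the domination by the finite measure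
    ([charge_cvg]), so finite additivity is all that has to be checked for
    set functions of the form A |-> phi (1_A). *)
Definition dominated_charge m :=
  (forall A B, measurable A -> measurable B -> A `&` B = set0 ->
     m (A `|` B) = m A + m B) /\
  exists C, forall A, measurable A -> `|m A| <= C * vol A.

Lemma vol_dominated : dominated_charge vol.
Proof.
split=> [A B mA mB AB|]; last first.
  by exists 1 => A mA; rewrite mul1r ger0_norm// vol_ge0.
apply: EFin_inj; rewrite EFinD !volE//; last exact: measurableU.
exact: measureU.
Qed.

Section dominated_charge_theory.
Context m (dm : dominated_charge m).

Lemma charge_diff A B : measurable A -> measurable B -> B `<=` A ->
  m (A `\` B) = m A - m B.
Proof.
move=> mA mB BA; apply/eqP; rewrite -subr_eq opprK eq_sym; apply/eqP.
rewrite -dm.1//; [by rewrite setDKU|exact: measurableD|].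
by rewrite setDE -setIA setICl setI0.
Qed.

Lemma charge_set0 : m set0 = 0.
Proof. by rewrite -(setDv set0) charge_diff// subrr. Qed.

Lemma charge_split A B : measurable A -> measurable B -> m A = m (A `&` B) + m (A `\` B).
Proof.
move=> mA mB; rewrite -dm.1 ?setUIDK//; [exact: measurableI|exact: measurableD|].
by rewrite setDE setIACA setICr setI0.
Qed.

End dominated_charge_theory.

Lemma le_vol A B : measurable A -> measurable B -> A `<=` B -> vol A <= vol B.
Proof.
move=> mA mB AB; rewrite -subr_ge0 -(charge_diff _ vol_dominated)//.
exact: vol_ge0.
Qed.

Lemma charge_cvg m (F : nat -> set Om) : dominated_charge m ->
  (forall n, measurable (F n)) -> (forall n, F n `<=` F n.+1) ->
  (fun n => m (F n)) @ \oo --> m (\bigcup_n F n).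
Proof.
move=> dm mF Fnd; set S := \bigcup_n F n.
have mS : measurable S by exact: bigcup_measurable.
have FS n : F n `<=` S by move=> x Fx; exists n.
have volcvg : (fun n => vol (F n)) @ \oo --> vol S.
  apply: fine_cvg; rewrite volE//.
  apply: nondecreasing_cvg_mu => //; apply/nondecreasing_seqP => n.
  exact/subsetPset/Fnd.
have [C mC] := dm.2.
have h : (fun n => C * (vol S - vol (F n))) @ \oo --> (0 : R).
  rewrite -(mulr0 C) -(subrr (vol S)).
  by apply: cvgM; [exact: cvg_cst|apply: cvgB => //; exact: cvg_cst].
apply/cvgrPdist_le => e e0.
have /cvgrPdist_le /(_ e e0) := h; apply: filterS => n.
rewrite sub0r normrN => he; rewrite -(charge_diff _ dm)//.
apply: le_trans (mC _ _) _; first exact: measurableD.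
rewrite (charge_diff _ vol_dominated)//.
by apply: le_trans he; exact: ler_norm.
Qed.

Definition halves (M : set (set Om -> R)) := forall A, measurable A ->
  exists B, [/\ measurable B, B `<=` A & forall m, M m -> m B = m A / 2].

(** Extending families indexed by [0, 1] to all of R keeps them globally
    Lipschitz. *)
Definition clamp (t : R) := Num.min (Num.max t 0) 1.

Lemma clamp_itv t : 0 <= clamp t <= 1.
Proof.
rewrite /clamp; case: (leP t 0) => t0; first by case: (leP (0 : R) 1); lra.
by case: (leP t 1) => t1; lra.
Qed.

Lemma clamp_id t : 0 <= t <= 1 -> clamp t = t.
Proof.
rewrite /clamp; case: (leP t 0) => t0; first by case: (leP (0 : R) 1); lra.
by case: (leP t 1) => t1; lra.
Qed.

Lemma clamp_homo s t : s <= t -> 0 <= clamp t - clamp s <= t - s.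
Proof.
move=> st; rewrite /clamp.
case: (leP t 0) => t0; case: (leP s 0) => s0; rewrite ?(@min_l _ _ 0 1) ?ler01//;
  try case: (leP t 1) => t1; try case: (leP s 1) => s1; lra.
Qed.

Lemma lipschitz_IVT (f : R -> R) (C a b v : R) : a <= b ->
  (forall s t, s <= t -> `|f t - f s| <= C * (t - s)) ->
  Num.min (f a) (f b) <= v <= Num.max (f a) (f b) ->
  exists2 c, a <= c <= b & f c = v.
Proof.
move=> ab lf fv; have [||c] := @IVT R f a b v ab => //; last first.
  by rewrite in_itv/= => ? ?; exists c.
apply: continuous_subspaceT => t; apply/cvgrPdist_le => e e0.
have C1 : 0 < `|C| + 1 by rewrite ltr_wpDl.
exists (e / (`|C| + 1)); first by rewrite /= divr_gt0.
move=> s /=; rewrite ltr_pdivlMr// => st.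
have /le_trans : `|f t - f s| <= C * `|t - s|.
  case/orP: (le_total t s) => ts.
    by rewrite distrC (distrC t) [X in _ * X]ger0_norm ?subr_ge0//; exact: lf.
  by rewrite [X in _ * X]ger0_norm ?subr_ge0//; exact: lf.
apply; apply: (le_trans _ (ltW st)); rewrite mulrC ler_wpM2l//.
by have := ler_norm C; lra.
Qed.

(** The measure of the part of A below t is a 1-Lipschitz function of t. *)
Lemma vol_halves : halves [set vol].
Proof.
move=> A mA.
pose I t : set Om := (`]-oo, t]%classic : set R).
have mI t : measurable (I t) by apply: sub_caratheodory; exact: (@measurable_itv R `]-oo, t]).
pose f t := vol (A `&` I t).
have mAI t : measurable (A `&` I t) by exact: measurableI.
have f_lip s t : s <= t -> `|f t - f s| <= 1 * (t - s).
  move=> st; rewrite /f.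
  have sub : A `&` I s `<=` A `&` I t.
    by move=> x [Ax]; rewrite /I/= !in_itv/= => xs; split=> //; exact: le_trans xs st.
  rewrite -(charge_diff _ vol_dominated)// ger0_norm ?vol_ge0// mul1r.
  rewrite -lee_fin volE//; last exact: measurableD.
  pose J : set Om := (`]s, t]%classic : set R).
  have mJ : measurable J by apply: sub_caratheodory; exact: (@measurable_itv R `]s, t]).
  have JE : (completed_lebesgue_measure : set Om -> \bar R) J = (t - s)%:E.
    rewrite [LHS](_ : _ = lebesgue_measure (`]s, t]%classic : set R))//.
    rewrite lebesgue_measure_itv /= lte_fin -EFinB.
    by case: ltP => // ts; congr EFin; apply/eqP; rewrite eq_le; lra.
  rewrite -JE mu01E; apply: le_measure; rewrite ?inE//.
    by apply: measurableI; [exact: measurableD|exact: measurable_unit_itv].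
  move=> x [[[Ax]]]; rewrite /I /J /= !in_itv /= => -> nx _.
  by rewrite andbT ltNge; apply/negP => xs; apply: nx.
have f0 : f 0 = 0.
  apply/eqP; rewrite eq_le vol_ge0 andbT -lee_fin volE//.
  pose J : set Om := (`[0, 0]%classic : set R).
  have mJ : measurable J by apply: sub_caratheodory; exact: (@measurable_itv R `[0, 0]).
  have J0 : ((completed_lebesgue_measure : set Om -> \bar R) J <= 0)%E.
    rewrite [leLHS](_ : _ = lebesgue_measure (`[0, 0]%classic : set R))//.
    by rewrite lebesgue_measure_itv /= lte_fin ltxx.
  apply: le_trans J0.
  rewrite mu01E; apply: le_measure; rewrite ?inE//.
    by apply: measurableI => //; exact: measurable_unit_itv.
  by move=> x [[Ax]]; rewrite /I /J /unit_itv /= !in_itv /= => -> /andP[-> _].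
have f1 : f 1 = vol A.
  rewrite /f /vol !mu01E -setIA; congr (fine (_ (A `&` _))).
  by apply: setIidr => x; rewrite /I /unit_itv /= !in_itv /= => /andP[].
have := vol_ge0 A => A0.
have [||t _ ft] := @lipschitz_IVT f 1 0 1 (vol A / 2) _ f_lip.
- by [].
- by rewrite f0 f1 min_l// max_r//; lra.
by exists (A `&` I t); split=> // m ->.
Qed.

Section dyadic_refinement.
Variables (M : set (set Om -> R)) (half : set Om -> set Om).
Hypothesis Mdom : forall m, M m -> dominated_charge m.
Hypothesis halfP : forall A, measurable A ->
  [/\ measurable (half A), half A `<=` A & forall m, M m -> m (half A) = m A / 2].
Variables (A : set Om) (mA : measurable A).

(** Iterated halving cuts A into 2 ^ n consecutive pieces at stage n;
    [dyadic_prefix n k] is the union of the first k of them. *)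
Fixpoint dyadic_prefix n k : set Om :=
  if n is n'.+1 then
    dyadic_prefix n' k./2 `|`
    (if odd k then half (dyadic_prefix n' k./2.+1 `\` dyadic_prefix n' k./2)
     else set0)
  else if k is 0%N then set0 else A.

Local Notation D := dyadic_prefix.

Lemma dyadic_prefix_double n k : D n.+1 k.*2 = D n k.
Proof. by rewrite /= odd_double doubleK setU0. Qed.

Lemma dyadic_prefix_odd n k : D n.+1 k.*2.+1 = D n k `|` half (D n k.+1 `\` D n k).
Proof. by rewrite /= odd_double /= uphalf_double. Qed.

Lemma dyadic_prefix_nested n k :
  [/\ measurable (D n k), D n k `<=` A & D n k `<=` D n k.+1].
Proof.
elim: n k => [|n IH] k; first by case: k => [|k] /=; split.
have [mk kA kk] := IH k./2; have [mk1 k1A _] := IH k./2.+1.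
have [mh hD _] := halfP _ (measurableD mk1 mk).
rewrite -(odd_double_half k); case: (odd k); last first.
  rewrite add0n dyadic_prefix_double dyadic_prefix_odd; split=> //.
rewrite add1n -doubleS dyadic_prefix_double dyadic_prefix_odd; split.
- exact: measurableU.
- by move=> x [/kA//|/hD[/k1A]].
- by move=> x [/kk//|/hD[]].
Qed.

Lemma dyadic_prefix_charge m n k : M m -> (k <= 2 ^ n)%N ->
  m (D n k) = k%:R / 2 ^+ n * m A.
Proof.
move=> Mm; have dm := Mdom _ Mm; elim: n k => [|n IH] k.
  case: k => [|[|//]] _ /=; first by rewrite (charge_set0 _ dm) !mul0r.
  by rewrite expr0 divr1 mul1r.
have pow2 : (2 : R) ^+ n != 0 by rewrite expf_neq0.
have [mk kA kk] := dyadic_prefix_nested n k./2.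
have [mk1 k1A _] := dyadic_prefix_nested n k./2.+1.
have [mh hD hm] := halfP _ (measurableD mk1 mk).
have kE := odd_double_half k; move: kE; case: (odd k) => <-; last first.
  rewrite add0n dyadic_prefix_double expnS mul2n leq_double => /IH ->.
  rewrite -muln2 natrM exprS invfM mulrA mulfK// ?pnatr_eq0//.
rewrite add1n dyadic_prefix_odd expnS mul2n ltn_double => kn.
rewrite dm.1//; last first.
  by rewrite -subset0 => x [Dx /hD[_]].
rewrite hm// (charge_diff _ dm)// !IH// ?(ltnW kn)// exprS.
rewrite -!natr1 -muln2 natrM; field.
by rewrite add0r.
Qed.

Lemma dyadic_prefix_homo n k l : (k <= l)%N -> D n k `<=` D n l.
Proof.
move=> /subnKC <-; elim: (l - k)%N => [|j IH]; first by rewrite addn0.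
rewrite addnS; apply: subset_trans IH _.
by have [] := dyadic_prefix_nested n (k + j).
Qed.

(** The increasing union of the dyadic approximations of t from below. *)
Definition fraction (t : R) : set Om := \bigcup_n D n (Num.trunc (2 ^+ n * clamp t)).

Let trunc_prefix t n : D n (Num.trunc (2 ^+ n * clamp t)) `<=`
  D n.+1 (Num.trunc (2 ^+ n.+1 * clamp t)).
Proof.
rewrite -dyadic_prefix_double; have /andP[t0 _] := clamp_itv t.
have : ((Num.trunc (2 ^+ n * clamp t)).*2 <= Num.trunc (2 ^+ n.+1 * clamp t))%N.
  rewrite truncn_ge_nat ?mulr_ge0 ?exprn_ge0// exprS -mulrA -muln2 natrM mulrC.
  by rewrite ler_wpM2l// truncn_le mulr_ge0 ?exprn_ge0.
exact: dyadic_prefix_homo.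
Qed.

Lemma fraction_measurable t : measurable (fraction t).
Proof.
apply: bigcup_measurable => n _.
by have [] := dyadic_prefix_nested n (Num.trunc (2 ^+ n * clamp t)).
Qed.

Lemma fraction_sub t : fraction t `<=` A.
Proof.
move=> x [n _].
by have [_ + _] := dyadic_prefix_nested n (Num.trunc (2 ^+ n * clamp t)); apply.
Qed.

Lemma fraction_homo s t : s <= t -> fraction s `<=` fraction t.
Proof.
move=> st x [n _ Dx]; exists n => //; apply: dyadic_prefix_homo Dx.
apply: le_truncn; rewrite ler_wpM2l ?exprn_ge0// -subr_ge0.
by have /andP[] := clamp_homo _ _ st.
Qed.

Lemma fraction_charge m t : M m -> m (fraction t) = clamp t * m A.
Proof.
move=> Mm; have dm := Mdom _ Mm; have /andP[t0 t1] := clamp_itv t.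
have c1 := @charge_cvg _ (fun n => D n (Num.trunc (2 ^+ n * clamp t))) dm.
have {}c1 := c1 (fun n => let: And3 h _ _ := dyadic_prefix_nested n _ in h) (trunc_prefix t).
rewrite -(cvg_lim _ c1)//; apply: cvg_lim => //.
rewrite (_ : (fun n => _) = fun n =>
  (Num.trunc (2 ^+ n * clamp t))%:R / 2 ^+ n * m A); last first.
  apply/funext => n; rewrite (dyadic_prefix_charge m)//.
  rewrite -(ler_nat R) natrX.
  apply: (@le_trans _ _ (2 ^+ n * clamp t)).
    by rewrite truncn_le mulr_ge0 ?exprn_ge0.
  by rewrite -[leRHS]mulr1 ler_wpM2l ?exprn_ge0.
apply: cvgM; last exact: cvg_cst.
have inv2 : (fun n => clamp t - (2 : R)^-1 ^+ n) @ \oo --> clamp t.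
  rewrite -[X in _ --> X]subr0; apply: cvgB; first exact: cvg_cst.
  by apply: cvg_expr; rewrite ger0_norm ?invr_ge0// invf_lt1 ?ltr1n.
apply: (squeeze_cvgr _ inv2 (cvg_cst _)); apply: nearW => n.
have p0 : 0 < (2 : R) ^+ n by rewrite exprn_gt0.
have /andP[l1 l2] := truncn_itv (mulr_ge0 (ltW p0) t0).
rewrite exprVn ler_pdivrMr// ler_pdivlMr// mulrBl mulVf ?gt_eqF// mulrC l1 andbT.
by rewrite lerBlDr natr1 ltW// mulrC.
Qed.

End dyadic_refinement.

Lemma halves_family (M : set (set Om -> R)) A :
  (forall m, M m -> dominated_charge m) -> halves M -> measurable A ->
  exists S : R -> set Om,
    [/\ forall t, measurable (S t), forall t, S t `<=` A,
        forall s t, s <= t -> S s `<=` S t &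
        forall m t, M m -> m (S t) = clamp t * m A].
Proof.
move=> Mdom hM mA.
have /choice[half halfP] : forall B, exists H, measurable B ->
    [/\ measurable H, H `<=` B & forall m, M m -> m H = m B / 2].
  move=> B; have [mB|nmB] := pselect (measurable B); last by exists set0.
  by have [H HP] := hM _ mB; exists H.
exists (fraction half A); split.
- by move=> t; exact: (fraction_measurable M).
- by move=> t; exact: (fraction_sub M).
- by move=> s t; exact: (fraction_homo M).
- by move=> m t; exact: (fraction_charge M).
Qed.

(** Along the family S t that divides the members of M proportionally, the value
    of m0 on the window between S t and S (t + 1/2) varies continuously, and
    its values at t = 0 and t = 1/2 add up to m0 A: somewhere between it is
    half of m0 A. Every window halves the members of M. *)
Lemma halves_add (M : set (set Om -> R)) m0 :
  (forall m, M m -> dominated_charge m) -> dominated_charge m0 -> M vol ->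
  halves M -> halves (M `|` [set m0]).
Proof.
move=> Mdom dm0 Mvol hM A mA.
have [S [mS SA Sle SM]] := halves_family _ _ Mdom hM mA.
have [C mC] := dm0.2.
have lipS s t : s <= t -> `|m0 (S t) - m0 (S s)| <= `|C| * vol A * (t - s).
  move=> st; rewrite -(charge_diff _ dm0)//; last exact: Sle.
  apply: le_trans (mC _ _) _; first exact: measurableD.
  rewrite (charge_diff _ vol_dominated)//; last exact: Sle.
  rewrite !SM// -mulrBl [X in _ * X]mulrC mulrA.
  have /andP[c0 c1] := clamp_homo _ _ st; have := vol_ge0 A => A0.
  apply: (@le_trans _ _ (`|C| * vol A * (clamp t - clamp s))).
    by rewrite ler_wpM2r// ler_wpM2r// ler_norm.
  by rewrite ler_wpM2l// mulr_ge0.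
pose f t := m0 (S (t + 2^-1)) - m0 (S t).
have flip s t : s <= t -> `|f t - f s| <= 2 * (`|C| * vol A) * (t - s).
  move=> st; have := lipS s t st; have := lipS (s + 2^-1) (t + 2^-1).
  rewrite lerD2r => /(_ st) h1 h2; rewrite /f opprB addrACA.
  have -> : m0 (S (t + 2^-1)) + m0 (S s) + (- m0 (S t) - m0 (S (s + 2^-1))) =
    (m0 (S (t + 2^-1)) - m0 (S (s + 2^-1))) - (m0 (S t) - m0 (S s)) by ring.
  apply: le_trans (ler_normB _ _) _; lra.
have null B : measurable B -> vol B = 0 -> m0 B = 0.
  move=> mB B0; apply/eqP; rewrite -normr_le0; apply: le_trans (mC _ mB) _.
  by rewrite B0 mulr0.
have S0 : m0 (S 0) = 0.
  by apply: null => //; rewrite SM// clamp_id ?lexx ?ler01// mul0r.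
have S1 : m0 (S 1) = m0 A.
  apply/eqP; rewrite eq_sym -subr_eq0 -(charge_diff _ dm0)//; apply/eqP/null.
    exact: measurableD.
  rewrite (charge_diff _ vol_dominated)// SM// clamp_id ?lexx ?ler01// mul1r.
  by rewrite subrr.
have fsum : f 0 + f 2^-1 = m0 A.
  have h : (2^-1 + 2^-1 : R) = 1 by lra.
  by rewrite /f add0r h S0 S1; ring.
have [||t /andP[t0 t1] ft] := @lipschitz_IVT f _ 0 2^-1 (m0 A / 2) _ flip.
- lra.
- rewrite -fsum; case: (leP (f 0) (f 2^-1)) => h; apply/andP; split; lra.
have tt : t <= t + 2^-1 by lra.
exists (S (t + 2^-1) `\` S t); split.
- exact: measurableD.
- by move=> x [/SA].
- move=> m [Mm|->]; last by rewrite (charge_diff _ dm0)//; exact: Sle.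
  rewrite (charge_diff _ (Mdom _ Mm))//; last exact: Sle.
  rewrite !SM// !clamp_id; [lra| |]; apply/andP; split; lra.
Qed.

Lemma halves_finite (ms : nat -> set Om -> R) p :
  (forall i, dominated_charge (ms i)) ->
  halves ([set vol] `|` ms @` `I_p).
Proof.
move=> msdom; elim: p => [|p IH]; first by rewrite II0 image_set0 setU0; exact: vol_halves.
rewrite IIS image_setU image_set1 setUA; apply: halves_add => //; last by left.
by move=> m [->|[i _ <-]]; [exact: vol_dominated|exact: msdom].
Qed.

Lemma lyapunov_fraction (ms : nat -> set Om -> R) p (t : R) A :
  (forall i, dominated_charge (ms i)) -> 0 <= t <= 1 -> measurable A ->
  exists B, [/\ measurable B, B `<=` A & forall i, (i < p)%N -> ms i B = t * ms i A].
Proof.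
move=> msdom t01 mA.
have Mdom : forall m, ([set vol] `|` ms @` `I_p) m -> dominated_charge m.
  by move=> m [->|[i _ <-]]; [exact: vol_dominated|exact: msdom].
have [S [mS SA _ SM]] := halves_family _ _ Mdom (halves_finite _ p msdom) mA.
exists (S t); split=> // i ip; rewrite SM ?clamp_id//.
by right; exists i.
Qed.

(** This is m E - m (A minus E), the value of m on the function equal to 1 on E
    and to -1 on the rest of A. *)
Definition imbalance m A E := 2 * m E - m A.

(** Keep the common part of E and F, and add the fraction t of E minus F and the
    fraction 1 - t of F minus E. *)
Lemma imbalance_convex (ms : nat -> set Om -> R) p (t : R) A E F :
  (forall i, dominated_charge (ms i)) -> 0 <= t <= 1 ->
  measurable A -> measurable E -> measurable F -> E `<=` A -> F `<=` A ->
  exists G, [/\ measurable G, G `<=` A & forall i, (i < p)%N ->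
    imbalance (ms i) A G = t * imbalance (ms i) A E + (1 - t) * imbalance (ms i) A F].
Proof.
move=> msdom t01 mA mE mF EA FA.
have t01' : 0 <= 1 - t <= 1 by lra.
have mEF : measurable (E `\` F) by exact: measurableD.
have mFE : measurable (F `\` E) by exact: measurableD.
have mI : measurable (E `&` F) by exact: measurableI.
have [P [mP PEF msP]] := lyapunov_fraction ms p t _ msdom t01 mEF.
have [Q [mQ QFE msQ]] := lyapunov_fraction ms p _ _ msdom t01' mFE.
exists ((E `&` F) `|` (P `|` Q)); split.
- by apply: measurableU => //; exact: measurableU.
- by move=> x [[/EA]//|[/PEF[/EA]//|/QFE[/FA]]].
move=> i ip; have dm := msdom i.
rewrite /imbalance (dm.1 _ _ mI)//; last 2 first.
- exact: measurableU.
- by rewrite -subset0 => x [[Ex Fx] [/PEF[_]//|/QFE[_]]].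
rewrite (dm.1 _ _ mP)//; last first.
  by rewrite -subset0 => x [/PEF[Ex _] /QFE[]].
rewrite msP// msQ// (charge_split _ dm _ _ mE mF) (charge_split _ dm _ _ mF mE) (setIC F).
ring.
Qed.

End nonatomic.

(** * Limits along ultrafilters *)

Section ultralimits.
Context {R : realType} (U : set_system nat) (UU : UltraFilter U).

Lemma ultra_bounded_cvg (u : nat -> R) M : (forall n, `|u n| <= M) ->
  exists l : R, u n @[n --> U] --> l.
Proof.
move=> uM; have := @segment_compact R (- M) M; rewrite compact_ultra.
have UuP : UltraFilter (u n @[n --> U]).
  split; first exact: fmap_proper_filter.
  move=> G GP uG; rewrite predeqE => V; split; last exact: uG.
  move=> GV; have [//|UnV] := @in_ultra_setVsetC _ U (u @^-1` V) UU.
  have GnV : G (~` V) by apply: uG; exact: UnV.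
  by have [x [Vx nVx]] := @filter_ex _ _ GP _ (filterI GV GnV).
move=> /(_ _ UuP)[|l [_ ul]]; last by exists l.
by apply: nearW => n /=; rewrite in_itv /= -ler_norml.
Qed.

Lemma near_forall_lt (F : set_system nat) (FF : Filter F) p (Q : nat -> nat -> Prop) :
  (forall i, (i < p)%N -> \forall n \near F, Q i n) ->
  \forall n \near F, forall i, (i < p)%N -> Q i n.
Proof.
elim: p => [|p IH] h; first exact: nearW.
have h1 := IH (fun i ip => h i (ltnW ip)); have h2 := h p (ltnSn p).
near=> n => i; rewrite ltnS leq_eqVlt => /predU1P[->|].
  by near: n.
by move: i; near: n.
Unshelve. all: by end_near. Qed.

End ultralimits.

(** * Splittings annihilated by finitely many functionals *)

Section exact_splitting.
Context {R : realType} (U : set_system nat) (UU : UltraFilter U).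
Local Notation Om := (lebesgue_line R).
(** The set functions nu n tend to 0 on each fixed set along U, and yet their
    variation on the subsets A of B remains at least delta * vol A. *)
Variables (nu : nat -> set Om -> R) (C delta : R) (B : set Om).
Hypothesis nu_dom : forall n, dominated_charge (nu n).
Hypothesis nu_le : forall n A, measurable A -> `|nu n A| <= C * vol A.
Hypothesis nu_cvg0 : forall A, measurable A -> nu n A @[n --> U] --> 0.
Hypothesis delta0 : 0 < delta.
Hypothesis nu_oscillates : forall A, measurable A -> A `<=` B -> forall e, 0 < e ->
  \forall n \near U, exists P, [/\ measurable P, P `<=` A &
    delta * vol A - e <= imbalance (nu n) A P].

Variables (ms : nat -> set Om -> R) (p : nat) (A : set Om).
Hypothesis ms_dom : forall i, dominated_charge (ms i).
Hypotheses (mA : measurable A) (AB : A `<=` B).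

Lemma imbalance_compl m E : dominated_charge m -> measurable E -> E `<=` A ->
  imbalance m A (A `\` E) = - imbalance m A E.
Proof. by move=> dm mE EA; rewrite /imbalance (charge_diff _ dm)//; ring. Qed.

Lemma imbalance_bound m D E : (forall F, measurable F -> `|m F| <= D * vol F) ->
  measurable E -> E `<=` A -> `|imbalance m A E| <= 3 * (`|D| * vol A).
Proof.
move=> mD mE EA; rewrite /imbalance; apply: le_trans (ler_normB _ _) _.
rewrite normrM ger0_norm//; have := mD _ mE; have := mD _ mA.
have := le_vol _ _ mE mA EA; have := vol_ge0 E; have := ler_norm D.
have := normr_ge0 D; nra.
Qed.

Lemma uniform_bound : exists2 M, 0 <= M &
  forall E, measurable E -> E `<=` A ->
    (forall i, (i < p)%N -> `|imbalance (ms i) A E| <= M) /\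
    (forall n, `|imbalance (nu n) A E| <= M).
Proof.
have [M M0 MP] : exists2 M, 0 <= M & forall E, measurable E -> E `<=` A ->
    (forall i, (i < p)%N -> `|imbalance (ms i) A E| <= M).
  elim: p => [|q [M M0 MP]]; first by exists 0.
  have [D mD] := (ms_dom q).2.
  have D0 : 0 <= 3 * (`|D| * vol A) by rewrite !mulr_ge0// vol_ge0.
  exists (M + 3 * (`|D| * vol A)); first exact: addr_ge0.
  move=> E mE EA i; rewrite ltnS leq_eqVlt => /predU1P[->|iq].
    by rewrite ler_wpDl//; exact: imbalance_bound.
  by rewrite ler_wpDr//; exact: MP.
have D0 : 0 <= 3 * (`|C| * vol A) by rewrite !mulr_ge0// vol_ge0.
exists (M + 3 * (`|C| * vol A)); first exact: addr_ge0.
move=> E mE EA; split => [i ip|n].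
  by rewrite ler_wpDr//; exact: MP.
by rewrite ler_wpDl//; apply: imbalance_bound => // F mF; exact: nu_le.
Qed.

Let mix_splittings n t E F : 0 <= t <= 1 -> measurable E -> measurable F -> E `<=` A -> F `<=` A ->
  exists G, [/\ measurable G, G `<=` A,
    forall i, (i < p)%N ->
      imbalance (ms i) A G = t * imbalance (ms i) A E + (1 - t) * imbalance (ms i) A F &
    imbalance (nu n) A G = t * imbalance (nu n) A E + (1 - t) * imbalance (nu n) A F].
Proof.
move=> t01 mE mF EA FA; pose ms' i := if (i < p)%N then ms i else nu n.
have ms'_dom i : dominated_charge (ms' i) by rewrite /ms'; case: ifP.
have [G [mG GA Gs]] := imbalance_convex ms' p.+1 t A E F ms'_dom t01 mA mE mF EA FA.
exists G; split=> //.
  by move=> i ip; have := Gs i (ltnW ip); rewrite /ms' ip.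
by have := Gs p (ltnSn p); rewrite /ms' ltnn.
Qed.

(** Let P n split A with imbalance close to delta * vol A for nu n. The
    imbalances of the ms i at P n converge along U, so those at P n and at a
    fixed P n0 nearly agree, whereas the imbalance of nu n at P n0 is nearly
    0. The average of P n and of the complement of P n0 has small imbalances
    for the ms i and keeps half of that of nu n. *)
Lemma almost_exact_splitting e : 0 < e -> \forall n \near U,
  exists E, [/\ measurable E, E `<=` A,
    forall i, (i < p)%N -> `|imbalance (ms i) A E| <= e &
    delta / 2 * vol A - e <= imbalance (nu n) A E].
Proof.
move=> e0; have [M M0 MP] := uniform_bound.
have /choice[P PP] : forall n, exists P, measurable P /\ P `<=` A /\
    ((exists P, [/\ measurable P, P `<=` A &
        delta * vol A - e <= imbalance (nu n) A P]) ->
      delta * vol A - e <= imbalance (nu n) A P).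
  move=> n; have [[P [mP PA h]]|nP] := pselect (exists P, [/\ measurable P, P `<=` A &
        delta * vol A - e <= imbalance (nu n) A P]); first by exists P.
  by exists set0; split=> //; split.
have mP n : measurable (P n) by have [] := PP n.
have PA n : P n `<=` A by have [_ []] := PP n.
have Pnear : \forall n \near U, delta * vol A - e <= imbalance (nu n) A (P n).
  by apply: filterS (nu_oscillates _ mA AB _ e0) => n; have [_ [_]] := PP n.
have /choice[l lP] : forall i, exists l : R, (i < p)%N ->
    imbalance (ms i) A (P n) @[n --> U] --> l.
  move=> i; have [ip|] := boolP (i < p)%N; last by exists 0.
  have [l lP] := ultra_bounded_cvg _ UU (fun n => imbalance (ms i) A (P n)) M
    (fun n => (MP _ (mP n) (PA n)).1 i ip).
  by exists l.
have closel : \forall n \near U, forall i, (i < p)%N ->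
    `|l i - imbalance (ms i) A (P n)| <= e.
  by apply: near_forall_lt => i ip; move/cvgrPdist_le: (lP i ip); apply.
have [n0 Pn0] := @filter_ex _ U _ _ closel.
have nu_n0 : \forall n \near U, `|0 - imbalance (nu n) A (P n0)| <= e.
  have h : imbalance (nu n) A (P n0) @[n --> U] --> (2 * 0 - 0 : R).
    by apply: cvgB; [apply: cvgM; [exact: cvg_cst|exact: nu_cvg0]|exact: nu_cvg0].
  by rewrite mulr0 subr0 in h; move/cvgrPdist_le: h; apply.
near=> n.
have h01 : 0 <= (2^-1 : R) <= 1 by lra.
have [G [mG GA Gs Gnu]] := mix_splittings n _ (P n) (A `\` P n0) h01 (mP n)
  (measurableD mA (mP n0)) (PA n) (fun x => @proj1 _ _).
exists G; split=> //.
  move=> i ip; rewrite Gs// imbalance_compl//.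
  have hn : `|l i - imbalance (ms i) A (P n)| <= e by move: i ip; near: n.
  have := Pn0 i ip; move: hn; rewrite !ler_norml => /andP[? ?] /andP[? ?].
  by apply/andP; split; lra.
rewrite Gnu imbalance_compl//.
have hn : `|0 - imbalance (nu n) A (P n0)| <= e by near: n.
have hP : delta * vol A - e <= imbalance (nu n) A (P n) by near: n.
move: hn; rewrite ler_norml => /andP[? ?]; lra.
Unshelve. all: by end_near. Qed.

(** If every splitting that is exact for ms 0, ..., ms (k - 1) is exact for ms k,
    there is nothing to do. Otherwise some fixed F is exact for these but has
    imbalance a <> 0 for ms k; an error at most e' for ms k is compensated by
    mixing in F, or its complement, with a weight at most e' / a. As a does not
    depend on n, choosing e' small makes the damage arbitrarily small. *)
Lemma partly_exact_splitting k : (k <= p)%N -> forall e, 0 < e -> \forall n \near U,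
  exists E, [/\ measurable E, E `<=` A,
    forall i, (i < k)%N -> imbalance (ms i) A E = 0,
    forall i, (i < p)%N -> `|imbalance (ms i) A E| <= e &
    delta / 2 * vol A - e <= imbalance (nu n) A E].
Proof.
elim: k => [_ e e0|k IH kp e e0].
  by apply: filterS (almost_exact_splitting _ e0) => n [E [? ? ? ?]]; exists E.
have [[F [mF FA F0 Fk]]|nF] := pselect (exists F, [/\ measurable F, F `<=` A,
    forall i, (i < k)%N -> imbalance (ms i) A F = 0 & imbalance (ms k) A F != 0]); last first.
  apply: filterS (IH (ltnW kp) _ e0) => n [E [mE EA E0 Ee Enu]]; exists E; split=> //.
  move=> i; rewrite ltnS leq_eqVlt => /predU1P[->|]; last exact: E0.
  by apply: contrapT => /eqP Ek; apply: nF; exists E.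
have [M M0 MP] := uniform_bound.
set a := `|imbalance (ms k) A F|.
have a0 : 0 < a by rewrite normr_gt0.
set c := delta / 2 * vol A.
have c0 : 0 <= c by rewrite mulr_ge0 ?vol_ge0// divr_ge0 ?ltW.
(* e' solves e' + (e' / a) * (M + c) = e, where M + c bounds the damage done by
   a unit of weight put on F. *)
set e' := e * a / (a + M + c).
have aMc : 0 < a + M + c by lra.
have e'0 : 0 < e' by rewrite divr_gt0// mulr_gt0.
have e'E : e' * (a + M + c) = e * a by rewrite /e' divfK// gt_eqF.
apply: filterS (IH (ltnW kp) _ e'0) => n [E [mE EA E0 Ee Enu]].
set x := imbalance (ms k) A E.
have [F' [mF' F'A F'0 F'k]] : exists F', [/\ measurable F', F' `<=` A,
    forall i, (i < k)%N -> imbalance (ms i) A F' = 0 &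
    a * x + `|x| * imbalance (ms k) A F' = 0].
  have [G [mG GA G0 Gk]] : exists G, [/\ measurable G, G `<=` A,
      forall i, (i < k)%N -> imbalance (ms i) A G = 0 & imbalance (ms k) A G = a].
    have [Fpos|Fneg] := leP 0 (imbalance (ms k) A F).
      by exists F; split=> //; rewrite /a ger0_norm.
    exists (A `\` F); split=> //; first exact: measurableD.
      by move=> i ik; rewrite imbalance_compl// F0// oppr0.
    by rewrite imbalance_compl// /a ltr0_norm.
  have [x0|x0] := leP 0 x; last first.
    by exists G; split=> //; rewrite Gk ltr0_norm//; ring.
  exists (A `\` G); split=> //; first exact: measurableD.
    by move=> i ik; rewrite imbalance_compl// G0// oppr0.
  by rewrite imbalance_compl// Gk ger0_norm//; ring.
have xe' : `|x| <= e' by exact: Ee.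
have x0 := normr_ge0 x.
have ax : 0 < a + `|x| by lra.
pose t := a / (a + `|x|).
have tE : t * (a + `|x|) = a by rewrite /t divfK// gt_eqF.
have t01 : 0 <= t <= 1.
  by rewrite divr_ge0 ?(ltW a0) ?(ltW ax)//= ler_pdivrMr// mul1r; lra.
clearbody t.
have t1E : (1 - t) * (a + `|x|) = `|x| by rewrite mulrBl tE mul1r addrC addKr.
have t1e : (1 - t) * a <= e'.
  apply: le_trans xe'; rewrite -t1E mulrDr lerDl mulr_ge0//; lra.
have key : e' + (1 - t) * (M + c) <= e.
  rewrite -(ler_pM2r a0) -e'E.
  have : (1 - t) * a * (M + c) <= e' * (M + c) by rewrite ler_wpM2r//; lra.
  lra.
have [G [mG GA Gs Gnu]] := mix_splittings n t E F' t01 mE mF' EA F'A.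
have [F'M F'nu] := MP _ mF' F'A.
have t1c : 0 <= (1 - t) * c by rewrite mulr_ge0//; lra.
exists G; split=> //.
- move=> i; rewrite ltnS leq_eqVlt => /predU1P[->|ik]; last first.
    by rewrite Gs ?(ltn_trans ik)// E0// F'0// !mulr0 addr0.
  rewrite Gs//; apply: (mulIf (lt0r_neq0 ax)).
  by rewrite mul0r mulrDl mulrAC tE [X in _ + X]mulrAC t1E -[RHS]F'k.
- move=> i ip; rewrite Gs//; apply: le_trans key; apply: le_trans (ler_normD _ _) _.
  have /andP[t0 t1] := t01.
  rewrite !normrM (ger0_norm t0) (@ger0_norm _ (1 - t)); last by lra.
  apply: lerD; last by rewrite ler_wpM2l ?subr_ge0//; have := F'M i ip; lra.
  by have := Ee i ip; have := normr_ge0 (imbalance (ms i) A E); nra.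
- rewrite Gnu; have /andP[t0 t1] := t01; have := F'nu n.
  rewrite ler_norml => /andP[h1 _].
  have h2 : t * (c - e') <= t * imbalance (nu n) A E by rewrite ler_wpM2l.
  have h3 : (1 - t) * (- M) <= (1 - t) * imbalance (nu n) A F' by rewrite ler_wpM2l ?subr_ge0.
  have h4 : 0 <= (1 - t) * e' by rewrite mulr_ge0 ?subr_ge0// ltW.
  lra.
Qed.

Lemma exact_splitting : 0 < vol A -> \forall n \near U,
  exists E, [/\ measurable E, E `<=` A,
    forall i, (i < p)%N -> imbalance (ms i) A E = 0 &
    delta / 4 * vol A <= imbalance (nu n) A E].
Proof.
move=> A0; have e0 : 0 < delta / 4 * vol A by rewrite mulr_gt0// divr_gt0.
apply: filterS (partly_exact_splitting _ (leqnn p) _ e0) => n [E [? ? ? _ h]].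
by exists E; split=> //; apply: le_trans h; lra.
Qed.

End exact_splitting.

(** * Densities of dominated set functions *)

Section density.
Context {R : realType}.
Local Notation Om := (lebesgue_line R).
Local Notation mu := (mu01 R).
Implicit Types (A B : set Om) (m : set Om -> R) (f D : Om -> R).

Definition intble f := mu.-integrable setT (EFin \o f).

Definition bounded_mfun (C : R) D := measurable_fun setT D /\ forall x, `|D x| <= C.

Lemma bounded_intble C D : bounded_mfun C D -> intble D.
Proof.
move=> [mD DC]; apply: measurable_bounded_integrable => //.
  by rewrite -ge0_fin_numE// fin_num_measure.
exists C; split; first by rewrite num_real.
by move=> M /ltW CM x _; exact: le_trans (DC x) CM.
Qed.

Lemma bounded_intbleM C D f : bounded_mfun C D -> intble f ->
  intble (fun x => D x * f x).
Proof.
move=> [mD DC] fi; rewrite /intble (_ : _ \o _ = (EFin \o D) \* (EFin \o f))%E//.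
apply: integrableMr => //.
exists C; split; first by rewrite num_real.
by move=> M /ltW CM x _; exact: le_trans (DC x) CM.
Qed.

Lemma intbleD (u v : Om -> R) :
  intble u -> intble v -> intble (fun x => u x + v x).
Proof.
move=> iu iv; rewrite /intble (_ : _ \o _ = (EFin \o u) \+ (EFin \o v))%E//.
exact: integrableD.
Qed.

Lemma intbleS A f : measurable A -> intble f -> mu.-integrable A (EFin \o f).
Proof. by move=> mA; exact: integrableS. Qed.

Lemma measurable_above f C : measurable_fun setT f -> measurable [set x | C < f x].
Proof.
move=> mf; rewrite (_ : [set x | C < f x] = f @^-1` `]C, +oo[%classic).
  by rewrite -[X in measurable X]setTI; exact: mf.
by apply/seteqP; split=> x /=; rewrite in_itv/= andbT.
Qed.

Lemma vol_setU_null A B : measurable A -> measurable B -> vol A = 0 -> vol B = 0 ->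
  vol (A `|` B) = 0.
Proof.
move=> mA mB A0 B0; apply/eqP; rewrite eq_le vol_ge0 andbT.
rewrite (charge_split _ vol_dominated (A `|` B) A)//; last exact: measurableU.
rewrite (setIidr (@subsetUl _ _ _)).
rewrite A0 add0r -B0; apply: le_vol => //.
  by apply: measurableD => //; exact: measurableU.
by move=> x [[]].
Qed.

(** The integral of f - C over the set where it is positive is at most 0, hence
    this set is negligible. *)
Lemma ess_upper_bound f C : intble f ->
  (forall A, measurable A -> \int[mu]_(x in A) f x <= C * vol A) ->
  vol [set x | C < f x] = 0.
Proof.
move=> fi fC; set P := [set x | C < f x].
have mf : measurable_fun setT f by apply/measurable_EFinP; exact: measurable_int fi.
have mP : measurable P by exact: measurable_above.
have iC : mu.-integrable P (EFin \o cst C) by exact: finite_measure_integrable_cst.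
have iP := intbleS P f mP fi.
pose g x := f x - C.
have I0 : \int[mu]_(x in P) g x = 0.
  apply/eqP; rewrite eq_le; apply/andP; split.
    rewrite RintegralB// subr_le0; apply: le_trans (fC _ mP) _.
    by rewrite Rintegral_cst.
  by apply: Rintegral_ge0 => x; rewrite /P/= => /ltW; rewrite subr_ge0.
have fC_meas : measurable_fun P (EFin \o g).
  apply/measurable_EFinP/measurable_funB => //.
  exact: measurable_funTS.
have iB : mu.-integrable P (EFin \o g).
  rewrite (_ : _ \o _ = (EFin \o f) \- (EFin \o cst C))%E//; exact: integrableB.
have : (\int[mu]_(x in P) `|(EFin \o g) x| = 0)%E.
  transitivity (\int[mu]_(x in P) (EFin \o g) x)%E.
    apply: eq_integral => x; rewrite inE /P/= => Cf.
    by rewrite ger0_norm// subr_ge0 ltW.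
  rewrite -[LHS]fineK; first by congr EFin.
  exact: integrable_fin_num.
move/(ae_eq_integral_abs _ mP fC_meas) => ae0.
have /measure_negligible : mu.-negligible P.
  move: ae0; rewrite /ae_eq => -[N [mN N0 sub]]; exists N; split=> // x Px.
  apply: sub => /= /(_ Px) [] /eqP; rewrite subr_eq0 => /eqP fxC.
  by move: Px; rewrite /P/= fxC ltxx.
by move=> /(_ mP); rewrite /vol => ->.
Qed.

(** The Radon-Nikodym theorem, with a density bounded everywhere: the derivative
    is replaced by 0 on the negligible set where it exceeds C in absolute
    value. *)
Lemma charge_density m C : dominated_charge m -> 0 <= C ->
  (forall A, measurable A -> `|m A| <= C * vol A) ->
  exists2 D, bounded_mfun C D &
    forall A, measurable A -> m A = \int[mu]_(x in A) D x.
Proof.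
move=> dm C0 mC; pose nu A := (m A)%:E.
have nu0 : nu set0 = 0%E by rewrite /nu (charge_set0 _ dm).
have nufin A : measurable A -> nu A \is a fin_num by [].
have nusig : semi_sigma_additive nu.
  move=> F mF tF mUF.
  pose G n := \big[setU/set0]_(i < n) F i.
  have mG n : measurable (G n) by exact: bigsetU_measurable.
  have -> : \bigcup_n F n = \bigcup_n G n.
    apply/seteqP; split=> x [n _].
      by move=> Fx; exists n.+1 => //; rewrite /G -bigcup_mkord; exists n => /=.
    by rewrite /G -bigcup_mkord => -[i _ Fx]; exists i.
  have -> : (fun n => \sum_(0 <= i < n) nu (F i))%E = (fun n => (m (G n))%:E).
    apply/funext => n; rewrite sumEFin; congr EFin.
    elim: n => [|n IH]; first by rewrite big_nil /G big_ord0 (charge_set0 _ dm).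
    rewrite big_nat_recr//= IH /G big_ord_recr /= dm.1//.
      by rewrite -/(G n).
    by apply: (@trivIset_bigsetUI _ predT) => //; apply: sub_trivIset tF.
  apply: cvg_EFin; first exact: nearW.
  rewrite (_ : fine \o _ = fun n => m (G n))//.
  apply: charge_cvg => // n; rewrite /G big_ord_recr /=; exact: subsetUl.
pose Mnu := isCharge.Build _ Om R nu nu0 nufin nusig.
pose nuc : {charge set Om -> \bar R} := HB.pack nu Mnu.
have nuac : nuc `<< mu.
  move=> N N0 A mA AN; have A0 := N0 A mA AN; rewrite /nuc /= /nu.
  congr EFin; apply/eqP; rewrite -normr_le0; apply: le_trans (mC _ mA) _.
  by rewrite /vol A0 mulr0.
have fn := @Radon_Nikodym_fin_num _ _ _ nuc mu _ nuac.
pose D0 x := fine (Radon_Nikodym nuc mu x).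
have D0E : EFin \o D0 = Radon_Nikodym nuc mu.
  by apply/funext => x; rewrite /D0 /= fineK.
have D0i : intble D0 by rewrite /intble D0E; exact: Radon_Nikodym_integrable.
have mD0 : forall A, measurable A -> m A = \int[mu]_(x in A) D0 x.
  move=> A mA; apply: EFin_inj; rewrite -[LHS]/(nuc A).
  rewrite (Radon_Nikodym_integral nuac mA) /Rintegral fineK.
    by apply: eq_integral => x _; rewrite -D0E.
  by apply: integrable_fin_num => //; exact: intbleS.
have mfD0 : measurable_fun setT D0.
  by apply/measurable_EFinP; exact: measurable_int D0i.
have up : vol [set x | C < D0 x] = 0.
  apply: ess_upper_bound => // A mA; rewrite -mD0//.
  exact: le_trans (ler_norm _) (mC _ mA).
have dn : vol [set x | C < - D0 x] = 0.
  apply: ess_upper_bound => [|A mA].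
    rewrite /intble (_ : _ \o _ = -%E \o (EFin \o D0))%E//; exact: integrableN.
  rewrite (_ : \int[mu]_(x in A) - D0 x = - m A).
    by apply: le_trans (mC _ mA); rewrite -normrN ler_norm.
  rewrite mD0// -mulN1r -RintegralZl//; last exact: intbleS.
  by apply: eq_Rintegral => x _; rewrite mulN1r.
pose E : set Om := [set x | `|D0 x| <= C].
have mE : measurable E.
  rewrite (_ : E = (fun x => `|D0 x|) @^-1` `]-oo, C]%classic).
    by rewrite -[X in measurable X]setTI; apply: measurableT_comp.
  by apply/seteqP; split=> x; rewrite /E/= in_itv.
exists (D0 \_ E).
  split; first exact/(measurable_restrictT _ mE)/measurable_funTS.
  by move=> x; rewrite patchE; case: ifPn => [|_]; [rewrite inE|rewrite normr0].
move=> A mA; rewrite -Rintegral_mkcondr -mD0; last exact: measurableI.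
rewrite (charge_split _ dm A E)//.
suff -> : m (A `\` E) = 0 by rewrite addr0.
have mAE : measurable (A `\` E) by exact: measurableD.
apply/eqP; rewrite -normr_le0; apply: le_trans (mC _ mAE) _.
have mP1 := measurable_above D0 C mfD0.
have mP2 := measurable_above (fun x => - D0 x) C (measurable_funN mfD0).
rewrite -[leRHS](mulr0 C) -(vol_setU_null _ _ mP1 mP2 up dn) ler_wpM2l//.
apply: le_vol => //; first exact: measurableU.
move=> x [_] /negP; rewrite -ltNge ltr_normr => /orP[|]; [by left|by right].
Qed.

End density.

(** * Functionals on L1 *)

Section L1_pairing.
Context {R : realType}.
Local Notation Om := (lebesgue_line R).
Local Notation mu := (mu01 R).
Local Notation L := (L1 R).
Implicit Types (A B : set Om) (f g : L) (D u : Om -> R).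

Lemma L1_intble f : intble f.
Proof. exact/Lfun1_integrable/LfunP. Qed.

Lemma L1normE f : L1norm f = \int[mu]_x `|f x|.
Proof. by rewrite /L1norm Lnorm1. Qed.

Lemma L1norm_ge0 f : 0 <= L1norm f.
Proof. by rewrite L1normE; exact: Rintegral_ge0. Qed.

(** The default value 0, for functions that are not integrable, makes this a total
    function. *)
Definition toL1 u : L := insubd (0 : L) u.

Lemma toL1E u : intble u -> toL1 u = u :> (Om -> R).
Proof. by move=> ui; rewrite /toL1 /insubd insubT//; apply/Lfun1_integrable. Qed.

Definition indL1 A : L := toL1 \1_A.

Lemma indL1E A : measurable A -> indL1 A = \1_A :> (Om -> R).
Proof.
move=> mA; apply: toL1E; apply: (@bounded_intble _ 1); split.
  exact: measurable_indic.
by move=> x; rewrite indicE normr_nat lern1 leq_b1.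
Qed.

Lemma L1norm_ind A : measurable A -> L1norm (indL1 A) = vol A.
Proof.
move=> mA; rewrite L1normE indL1E// /vol -(setIT A) -integral_indic// /Rintegral.
by congr fine; apply: eq_integral => x _; rewrite setIT indicE normr_nat.
Qed.

Lemma indL1U A B : measurable A -> measurable B -> A `&` B = set0 ->
  indL1 (A `|` B) = indL1 A + indL1 B.
Proof.
move=> mA mB AB; apply/LfuneqP => x /=.
rewrite !indL1E//; last exact: measurableU.
rewrite -[RHS]/(\1_A x + \1_B x) !indicE in_setU.
have [xA|] := boolP (x \in A); last by rewrite add0r.
have [xB|] := boolP (x \in B); last by rewrite addr0.
suff : (A `&` B) x by rewrite AB.
by split; exact: set_mem.
Qed.

Definition pair D f : R := \int[mu]_x (D x * f x).

Lemma pair_bound C D f : bounded_mfun C D -> `|pair D f| <= C * L1norm f.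
Proof.
move=> bD; have [mD DC] := bD; have fi := L1_intble f.
apply: le_trans (le_normr_Rintegral _ _) _ => //; first exact: bounded_intbleM.
have afi : mu.-integrable setT (EFin \o (fun x => `|f x|)) by exact: integrable_norm.
rewrite L1normE -RintegralZl//; apply: le_Rintegral => //.
- apply: integrable_norm; exact: bounded_intbleM.
- rewrite (_ : _ \o _ = fun x => C%:E * (`|f x|)%:E)%E//; exact: integrableZl.
- by move=> x _; rewrite normrM ler_wpM2r.
Qed.

Lemma pair_linear C D : bounded_mfun C D ->
  forall a f g, pair D (a *: f + g) = a * pair D f + pair D g.
Proof.
move=> bD a f g; have fi := bounded_intbleM _ _ _ bD (L1_intble f).
have gi := bounded_intbleM _ _ _ bD (L1_intble g).
rewrite /pair -RintegralZl// -RintegralD//.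
  by apply: eq_Rintegral => x _; rewrite -[(a *: f + g) x]/(a * f x + g x); ring.
rewrite (_ : _ \o _ = fun x => a%:E * (D x * f x)%:E)%E//; exact: integrableZl.
Qed.

Lemma bounded_mfunD C C' D D' : bounded_mfun C D -> bounded_mfun C' D' ->
  bounded_mfun (C + C') (fun x => D x + D' x).
Proof.
move=> [mD DC] [mD' DC']; split; first exact: measurable_funD.
by move=> x; apply: le_trans (ler_normD _ _) _; exact: lerD.
Qed.

Lemma bounded_mfunN C D : bounded_mfun C D -> bounded_mfun C (fun x => - D x).
Proof.
by move=> [mD DC]; split; [exact: measurable_funN|move=> x; rewrite normrN].
Qed.

Lemma pairD C C' D D' f : bounded_mfun C D -> bounded_mfun C' D' ->
  pair (fun x => D x + D' x) f = pair D f + pair D' f.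
Proof.
move=> bD bD'; have iD := bounded_intbleM _ _ _ bD (L1_intble f).
have iD' := bounded_intbleM _ _ _ bD' (L1_intble f).
rewrite /pair -RintegralD//.
by apply: eq_Rintegral => x _; rewrite mulrDl.
Qed.

Lemma pairN C D f : bounded_mfun C D -> pair (fun x => - D x) f = - pair D f.
Proof.
move=> bD; have iDf := bounded_intbleM _ _ _ bD (L1_intble f).
rewrite /pair -mulN1r -RintegralZl//.
by apply: eq_Rintegral => x _; rewrite mulN1r mulNr.
Qed.

Lemma pair_ind C D A : bounded_mfun C D -> measurable A ->
  pair D (indL1 A) = \int[mu]_(x in A) D x.
Proof.
move=> bD mA; rewrite /pair indL1E// [RHS]Rintegral_mkcond.
apply: eq_Rintegral => x _; rewrite indicE patchE.
by case: (x \in A); rewrite ?mulr1 ?mulr0.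
Qed.

Lemma functional_sum (phi : {linear L -> R^o}) n (c : 'I_n -> R) (s : 'I_n -> L) :
  phi (\sum_(i < n) c i *: s i) = \sum_(i < n) c i * phi (s i).
Proof. by rewrite linear_sum; apply: eq_bigr => i _; rewrite linearZ. Qed.

Lemma simple_dense f e : 0 < e -> exists n (c : 'I_n -> R) (B : 'I_n -> set Om),
  (forall i, measurable (B i)) /\
  L1norm (f - \sum_(i < n) c i *: indL1 (B i)) <= e.
Proof.
move=> e0; have [g [gi _ gf]] := approximation_sfun_integrable measurableT (L1_intble f).
have /fine_fcvg/cvgrPdist_le/(_ _ e0)[N _ /(_ N (leqnn N))] := gf.
set s := g N; rewrite /= sub0r normrN => fN.
pose r := finmap.enum_fset (fset_set (range s)).
pose B (i : 'I_(size r)) : set Om := s @^-1` [set r`_i].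
have mB i : measurable (B i) by exact: (measurable_funPTI s (measurable_set1 _)).
exists (size r), (fun i => r`_i), B; split=> //.
rewrite L1normE; apply: le_trans fN; rewrite -[leLHS]ger0_norm; last exact: Rintegral_ge0.
rewrite le_eqVlt; apply/orP; left; apply/eqP; congr (`| fine _ |).
apply: eq_integral => x _; rewrite -[RHS]/((`|f x - s x|%R)%:E); congr (`|_ - _|%R%:E).
rewrite [RHS]fimfunE fsbig_finite//= -/r (big_nth 0) big_mkord.
have valS (t : 'I_(size r) -> L) : (\sum_i t i : L) x = \sum_i t i x.
  by elim/big_ind2 : _ => // a b c d <- <-.
by rewrite valS; apply: eq_bigr => i _ /=; rewrite indL1E.
Qed.

(** The dual of L1 is L-infinity: the functional and its density agree on
    indicators, hence on simple functions, which are dense. *)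
Lemma functional_density (phi : {linear L -> R^o}) C : 0 <= C ->
  (forall f, `|phi f| <= C * L1norm f) ->
  exists2 D, bounded_mfun C D & forall f, phi f = pair D f.
Proof.
move=> C0 phiC; pose m A := phi (indL1 A).
have mC A : measurable A -> `|m A| <= C * vol A.
  by move=> mA; rewrite -L1norm_ind//; exact: phiC.
have dm : dominated_charge m.
  split; last by exists C.
  by move=> A B mA mB AB; rewrite /m indL1U// linearD.
have [D bD mD] := charge_density _ _ dm C0 mC.
exists D => // f; apply/eqP; rewrite -subr_eq0 -normr_le0.
apply/ler_addgt0Pl => e e0; rewrite addr0.
have e1 : 0 < e / (2 * C + 1) by rewrite divr_gt0// ltr_wpDl// mulr_ge0.
have [n [c [B [mB fs]]]] := simple_dense f _ e1.
set s := \sum_(i < n) _ in fs.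
have pairlin := pair_linear _ _ bD.
have [psi psiE] := linear_bundle L (pair D) pairlin.
have sE : phi s = psi s.
  rewrite !functional_sum; apply: eq_bigr => i _; rewrite psiE.
  by rewrite (pair_ind _ _ _ bD)// -mD.
have h1 := phiC (f - s); have h2 := pair_bound _ _ (f - s) bD.
have -> : phi f - pair D f = phi (f - s) - psi (f - s).
  by rewrite [phi (_ - _)]linearB [psi (_ - _)]linearB sE !psiE /=; ring.
apply: le_trans (ler_normB _ _) _.
rewrite -psiE in h2; apply: (le_trans (lerD h1 h2)).
rewrite -mulrDl; apply: (@le_trans _ _ ((C + C) * (e / (2 * C + 1)))).
  by rewrite ler_wpM2l// addr_ge0.
rewrite mulrA ler_pdivrMr; last by rewrite ltr_wpDl// mulr_ge0.
by nra.
Qed.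

(** A fixed f in L1 acts continuously for the L1 norm on uniformly bounded
    functions u, since f is nearly a bounded function. *)
Lemma pair_small f e : 0 < e -> exists2 eta : R, 0 < eta &
  forall u, bounded_mfun 2 u -> \int[mu]_x `|u x| <= eta -> `|pair u f| <= e.
Proof.
move=> e0; have e4 : 0 < e / 4 by rewrite divr_gt0.
have [n [c [B [mB fs]]]] := simple_dense f _ e4.
set s := \sum_(i < n) _ in fs.
pose K := \sum_(i < n) `|c i|.
have K0 : 0 <= K by exact: sumr_ge0.
have K1 : 0 < K + 1 by rewrite ltr_wpDl.
exists (e / 2 / (K + 1)) => [|u bu ui]; first by rewrite !divr_gt0.
have [psi psiE] := linear_bundle L (pair u) (pair_linear _ _ bu).
have usB i : `|pair u (indL1 (B i))| <= e / 2 / (K + 1).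
  have ui' := bounded_intble _ _ bu.
  rewrite (pair_ind _ _ _ bu)//; apply: le_trans ui.
  apply: le_trans (le_normr_Rintegral _ _) _ => //; first exact: intbleS.
  rewrite Rintegral_mkcond; apply: le_Rintegral => //.
  - rewrite -restrict_EFin; apply: (integrable_mkcond _ (mB i)).1.
    by apply: intbleS => //; exact: integrable_norm.
  - exact: integrable_norm.
  - by move=> x _; rewrite patchE; case: ifP => _; [exact: lexx|exact: normr_ge0].
have -> : pair u f = psi (f - s) + psi s by rewrite -linearD subrK psiE.
apply: le_trans (ler_normD _ _) _.
have h2 := pair_bound _ _ (f - s) bu; rewrite -psiE in h2.
have h3 : `|psi s| <= K * (e / 2 / (K + 1)).
  rewrite functional_sum; apply: le_trans (ler_norm_sum _ _ _) _.
  rewrite mulr_suml; apply: ler_sum => i _; rewrite normrM psiE ler_wpM2l//.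
have h4 : K * (e / 2 / (K + 1)) <= e / 2.
  rewrite mulrA ler_pdivrMr// mulrC ler_wpM2l ?divr_ge0 ?(ltW e0)//; lra.
have h5 : 2 * L1norm (f - s) <= e / 2 by lra.
apply: le_trans (lerD (le_trans h2 h5) (le_trans h3 h4)) _; lra.
Qed.

End L1_pairing.

(** * The Dunford-Pettis property of L1 *)

Section dunford_pettis.
Context {R : realType}.
Local Notation Om := (lebesgue_line R).
Local Notation mu := (mu01 R).
Local Notation L := (L1 R).

(** An ultrafilter limit replaces the extraction of a weak-star convergent
    subsequence. *)
Lemma ultralimit_functional (U : set_system nat) (UU : UltraFilter U)
    (phi : nat -> L -> R) C :
  (forall n a f g, phi n (a *: f + g) = a * phi n f + phi n g) ->
  (forall n f, `|phi n f| <= C * L1norm f) ->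
  exists psi : {linear L -> R^o}, (forall f, phi n f @[n --> U] --> (psi f : R)) /\
    forall f, `|psi f| <= C * L1norm f.
Proof.
move=> phil phiC.
have /choice[l lP] : forall f, exists l : R, phi n f @[n --> U] --> l.
  by move=> f; apply: (ultra_bounded_cvg _ UU _ (C * L1norm f)) => n; exact: phiC.
have ll a f g : l (a *: f + g) = a * l f + l g.
  rewrite -(cvg_lim _ (lP (a *: f + g)))//; apply: cvg_lim => //.
  rewrite (_ : (fun n => _) = fun n => a * phi n f + phi n g); last first.
    by apply/funext => n; rewrite phil.
  by apply: cvgD; [apply: cvgM; [exact: cvg_cst|exact: lP]|exact: lP].
have [psi psiE] := linear_bundle L l ll.
exists psi; split=> f; rewrite psiE //.
have h : `|phi n f| @[n --> U] --> `|l f| by apply: cvg_norm; exact: lP.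
rewrite -(cvg_lim _ h)//; apply: limr_le; first by apply/cvg_ex; eexists; exact: h.
by apply: nearW => n; exact: phiC.
Qed.

Definition free_ultrafilter (U : set_system nat) := UltraFilter U /\ eventually `<=` U.

Lemma free_ultrafilter_exists : exists U, free_ultrafilter U.
Proof. by have [U [UU FU]] := @ultraFilterLemma nat eventually _; exists U. Qed.

Lemma L1dist_triangle (u v w : Om -> R) C : bounded_mfun C u -> bounded_mfun C v ->
  bounded_mfun C w ->
  \int[mu]_x `|u x - w x| <= \int[mu]_x `|u x - v x| + \int[mu]_x `|v x - w x|.
Proof.
move=> bu bv bw.
have i2 a b : bounded_mfun C a -> bounded_mfun C b -> intble (fun x => `|a x - b x|).
  move=> ba bb; apply: integrable_norm.
  exact: (bounded_intble _ _ (bounded_mfunD _ _ _ _ ba (bounded_mfunN _ _ bb))).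
rewrite -RintegralD//; [|exact: i2|exact: i2].
apply: le_Rintegral => //; first exact: i2.
  exact: (intbleD _ _ (i2 _ _ bu bv) (i2 _ _ bv bw)).
by move=> x _; rewrite -(subrKA (v x)); exact: ler_normD.
Qed.

(** A gliding hump. If the integrals of |D n| had arbitrarily small values,
    functions G k bounded by 1 could be built by
    G (k + 1) = G k * (1 - |D n| / C) + s * D n / C, where the sign s is chosen so
    that |pair (G (k + 1)) (f n)| >= e / C. With D n of tiny integral, the
    later changes of G hardly affect the pairing with f n. A limit functional
    psi of the G k would then satisfy |psi (f n)| >= e / (2 C) for infinitely
    many n, although f is weakly null. *)
Lemma dunford_pettis (D : nat -> Om -> R) C (f : nat -> L) e N0 : 0 < C ->
  (forall n, bounded_mfun C (D n)) -> L1_weak_cvg f 0 -> 0 < e ->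
  (forall n, (N0 <= n)%N -> e <= pair (D n) (f n)) ->
  exists2 th : R, 0 < th & exists N, forall n, (N <= n)%N -> th <= \int[mu]_x `|D n x|.
Proof.
move=> C0 bD fw e0 eD; apply: contrapT => nth.
have small th N : 0 < th -> exists2 n, (N <= n)%N & \int[mu]_x `|D n x| < th.
  move=> th0; apply: contrapT => h; apply: nth; exists th => //; exists N => n Nn.
  by rewrite leNgt; apply/negP => hn; apply: h; exists n.
(* A state (G k, eta, n) records the current function, the amount by which it
   may still change in L1 norm, and the index n handled last. *)
pose good (s : (Om -> R) * R * nat) := [/\ bounded_mfun 1 s.1.1, 0 < s.1.2,
  e / C <= `|pair s.1.1 (f s.2)| &
  forall u, bounded_mfun 2 u -> \int[mu]_x `|u x| <= s.1.2 ->
    `|pair u (f s.2)| <= e / C / 2].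
pose next (s t : (Om -> R) * R * nat) := [/\ (s.2 < t.2)%N, t.1.2 <= s.1.2 / 2 &
  \int[mu]_x `|t.1.1 x - s.1.1 x| <= s.1.2 / 2].
have eC0 : 0 < e / C by rewrite divr_gt0.
have step g eta n : bounded_mfun 1 g -> 0 < eta ->
    exists2 t, good t & next (g, eta, n) t.
  move=> [mg g1] eta0; have [n' nn' Dn'] := small (eta * C / 4) (maxn n.+1 N0)
    ltac:(by rewrite divr_gt0// mulr_gt0).
  have [mD DC] := bD n'.
  pose base x := g x * (1 - `|D n' x| / C).
  pose pert x := C^-1 * D n' x.
  have bbase : bounded_mfun 1 base.
    split.
      have mabs := measurableT_comp (@normr_measurable R setT) mD.
      have mcst (c : R) : measurable_fun setT (fun _ : Om => c) by exact: measurable_cst.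
      exact: (measurable_funM mg (measurable_funB (mcst 1) (measurable_funM mabs (mcst C^-1)))).
    move=> x; rewrite /base normrM -[leRHS]mul1r ler_pM//.
    have h : `|D n' x| / C <= 1 by rewrite ler_pdivrMr// mul1r.
    have h' : 0 <= `|D n' x| / C by rewrite divr_ge0// ltW.
    by rewrite ler_norml; lra.
  have bpert : bounded_mfun 1 pert.
    split; first exact: (measurable_funM (measurable_cst _) mD).
    by move=> x; rewrite /pert normrM gtr0_norm ?invr_gt0// ler_pdivrMl// mulr1.
  have pertE : pair pert (f n') = C^-1 * pair (D n') (f n').
    rewrite /pair -RintegralZl//; last exact: (bounded_intbleM _ _ _ (bD n') (L1_intble _)).
    by apply: eq_Rintegral => x _; rewrite /pert mulrA.
  have [s [s1 hs]] : exists s : R, `|s| = 1 /\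
      e / C <= `|pair base (f n') + s * pair pert (f n')|.
    have ep : e / C <= pair pert (f n').
      rewrite pertE mulrC ler_pM2l ?invr_gt0// eD//.
      by apply: leq_trans nn'; rewrite leq_maxr.
    have [b0|b0] := leP 0 (pair base (f n')).
      exists 1; rewrite normr1 mul1r ger0_norm; first by split=> //; lra.
      lra.
    exists (-1); rewrite normrN1 mulN1r ltr0_norm; first by split=> //; lra.
    lra.
  pose spert x := s * pert x.
  have bspert : bounded_mfun 1 spert.
    split; first exact: (measurable_funM (measurable_cst _) bpert.1).
    by move=> x; rewrite /spert normrM s1 mul1r; exact: bpert.2.
  have spertE : pair spert (f n') = s * pair pert (f n').
    rewrite /pair -RintegralZl//; last exact: (bounded_intbleM _ _ _ bpert (L1_intble _)).
    by apply: eq_Rintegral => x _; rewrite /spert mulrA.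
  pose g' x := base x + spert x.
  have bg' : bounded_mfun 1 g'.
    split; first exact: (measurable_funD bbase.1 bspert.1).
    move=> x; apply: le_trans (ler_normD _ _) _.
    rewrite /base /spert /pert !normrM s1 mul1r.
    have h : `|D n' x| / C <= 1 by rewrite ler_pdivrMr// mul1r.
    rewrite (gtr0_norm (x := C^-1)) ?invr_gt0// (mulrC C^-1).
    rewrite (@ger0_norm _ (1 - _)) ?subr_ge0//.
    have : `|g x| * (1 - `|D n' x| / C) <= 1 - `|D n' x| / C.
      by rewrite -[leRHS]mul1r ler_wpM2r// subr_ge0.
    lra.
  have [eta1 eta10 eta1P] := pair_small (f n') (e / C / 2) ltac:(by rewrite divr_gt0).
  exists (g', Num.min (eta / 2) eta1, n').
    split=> //=; first by rewrite lt_min eta10 divr_gt0.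
      by rewrite (pairD _ _ _ _ _ bbase bspert) spertE.
    by move=> u bu ui; apply: eta1P => //; apply: le_trans ui _; rewrite ge_min lexx orbT.
  split=> /=; first by apply: leq_trans nn'; rewrite leq_maxl.
    by rewrite ge_min lexx.
  have iD := bounded_intble _ _ (bD n').
  have iaD : intble (fun x => `|D n' x|) by exact: integrable_norm.
  apply: (@le_trans _ _ (\int[mu]_x (2 / C * `|D n' x|))).
    apply: le_Rintegral => //.
    - apply: integrable_norm; have bg : bounded_mfun 1 g by split.
      exact: (bounded_intble _ _ (bounded_mfunD _ _ _ _ bg' (bounded_mfunN _ _ bg))).
    - rewrite (_ : _ \o _ = fun x => (2 / C)%:E * (`|D n' x|)%:E)%E//; exact: integrableZl.
    - move=> x _; rewrite /g' /base /spert /pert.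
      have -> : g x * (1 - `|D n' x| / C) + s * (C^-1 * D n' x) - g x =
        s * (C^-1 * D n' x) - g x * (`|D n' x| / C) by ring.
      apply: le_trans (ler_normB _ _) _.
      rewrite !normrM s1 mul1r normr_id (gtr0_norm (x := C^-1)) ?invr_gt0//.
      have : `|g x| * (`|D n' x| * C^-1) <= `|D n' x| * C^-1.
        by rewrite -[leRHS]mul1r ler_wpM2r// mulr_ge0// invr_ge0 ltW.
      have -> : 2 / C * `|D n' x| = 2 * (`|D n' x| * C^-1) by ring.
      have -> : C^-1 * `|D n' x| = `|D n' x| * C^-1 by ring.
      lra.
  rewrite RintegralZl//; move: Dn'; set I := Rintegral _ _ _ => Dn'.
  have -> : eta / 2 = 2 / C * (eta * C / 4) by field; rewrite gt_eqF.
  by rewrite ler_wpM2l ?divr_ge0 ?ltW.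
have b0 : bounded_mfun 1 (fun _ : Om => 0 : R) by split=> // x; rewrite normr0.
have [s0 gs0 _] := step _ 1 0%N b0 ltr01.
have /choice[F FP] : forall s, exists t, good s -> good t /\ next s t.
  move=> [[g eta] n]; have [gs|ngs] := pselect (good (g, eta, n)); last by exists s0.
  by have [bg eta0 _ _] := gs; have [t gt nt] := step g eta n bg eta0; exists t.
pose S k := iter k F s0.
have gS k : good (S k) by elim: k => [//|k /FP[]].
have nS k : next (S k) (S k.+1) by have [] := FP _ (gS k).
pose G k := (S k).1.1; pose eta k := (S k).1.2; pose n_ k := (S k).2.
have bG k : bounded_mfun 1 (G k) by have [] := gS k.
have Gdist j k : (j <= k)%N -> \int[mu]_x `|G k x - G j x| <= eta j - eta k.
  move=> /subnKC <-; elim: (k - j)%N => [|i IH].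
    rewrite addn0 subrr le_eqVlt; apply/orP; left; apply/eqP.
    under eq_Rintegral do rewrite subrr normr0.
    by rewrite Rintegral_cst// mul0r.
  rewrite addnS; apply: le_trans (L1dist_triangle _ (G (j + i)%N) _ _ (bG _) (bG _) (bG _)) _.
  have [_ h1 h2] := nS (j + i)%N; rewrite -/(eta _) in h1 h2.
  rewrite -/(G (j + i).+1) -/(G (j + i)%N) -/(eta (j + i).+1) in h1 h2.
  lra.
have Glow j k : (j <= k)%N -> e / C / 2 <= `|pair (G k) (f (n_ j))|.
  move=> jk; have [_ _ h1 h2] := gS j.
  have bd : bounded_mfun 2 (fun x => G k x - G j x).
    by have := bounded_mfunD _ _ _ _ (bG k) (bounded_mfunN _ _ (bG j)).
  have := h2 _ bd; have [_ etak _ _] := gS k; rewrite -/(eta k) in etak.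
  move=> /(_ ltac:(by apply: le_trans (Gdist _ _ jk) _; rewrite -/(eta j); lra)).
  rewrite (pairD _ _ _ _ _ (bG k) (bounded_mfunN _ _ (bG j))) (pairN _ _ _ (bG j)).
  rewrite -/(n_ j) -/(G j) in h1 *.
  have := ler_normB (pair (G k) (f (n_ j))) (pair (G k) (f (n_ j)) - pair (G j) (f (n_ j))).
  rewrite opprB addrC subrK => h3 h4.
  lra.
have [U [UU FU]] := free_ultrafilter_exists.
have [psi [psiP psiC]] := ultralimit_functional U UU (fun k => pair (G k)) 1
  (fun k => pair_linear _ _ (bG k)) (fun k h => pair_bound _ _ h (bG k)).
have psilow j : e / C / 2 <= `|psi (f (n_ j))|.
  have h : `|pair (G k) (f (n_ j))| @[k --> U] --> `|psi (f (n_ j)) : R|.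
    by apply: cvg_norm; exact: psiP.
  rewrite -(cvg_lim _ h)//; apply: limr_ge; first by apply/cvg_ex; eexists; exact: h.
  by apply: FU; exists j => // k /= jk; exact: Glow.
have nj j : (j <= n_ j)%N.
  elim: j => // j IH; apply: leq_ltn_trans IH _; by have [] := nS j.
have := fw psi (ex_intro _ 1 psiC); rewrite linear0.
move=> /cvgrPdist_lt /(_ (e / C / 2)) [|N _ /(_ (n_ N) (nj N))]; first by rewrite divr_gt0.
by rewrite /= sub0r normrN ltNge psilow.
Qed.

End dunford_pettis.

(** * Oscillation of operators that are not completely continuous *)

Section oscillation.
Context {R : realType}.
Local Notation Om := (lebesgue_line R).
Local Notation mu := (mu01 R).
Local Notation L := (L1 R).

(** The splitting of A by the sign of D. *)
Lemma abs_charge C (D : Om -> R) A : bounded_mfun C D -> measurable A ->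
  exists P, [/\ measurable P, P `<=` A &
    imbalance (fun B => \int[mu]_(x in B) D x) A P = \int[mu]_(x in A) `|D x|].
Proof.
move=> bD mA; have [mD _] := bD; have iD := bounded_intble _ _ bD.
have mpos := measurable_above D 0 mD.
pose P := A `&` [set x | 0 < D x].
have mP : measurable P by exact: measurableI.
have PA : P `<=` A by exact: subIsetl.
have mQ : measurable (A `\` P) by exact: measurableD.
exists P; split=> //; rewrite /imbalance.
have split_A f : intble f ->
    \int[mu]_(x in A) f x = \int[mu]_(x in P) f x + \int[mu]_(x in A `\` P) f x.
  move=> fi; rewrite -{1}(setUIDK A P) (setIidr PA) Rintegral_setU//.
    by apply: intbleS => //; exact: measurableU.
  by apply/disj_setPS => x [Px [_]].
rewrite (split_A D)// (split_A (fun x => `|D x|)); last exact: integrable_norm.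
have -> : \int[mu]_(x in P) `|D x| = \int[mu]_(x in P) D x.
  by apply: eq_Rintegral => x /set_mem[_ /= /gtr0_norm].
have -> : \int[mu]_(x in A `\` P) `|D x| = - \int[mu]_(x in A `\` P) D x.
  rewrite -mulN1r -RintegralZl//; last exact: intbleS.
  apply: eq_Rintegral => x /set_mem[Ax nPx]; rewrite mulN1r ler0_norm// leNgt.
  by apply/negP => Dx; apply: nPx.
ring.
Qed.

Lemma abs_integral_charge C (D : Om -> R) : bounded_mfun C D ->
  dominated_charge (fun A => \int[mu]_(x in A) `|D x|) /\
  forall A, measurable A -> 0 <= \int[mu]_(x in A) `|D x| <= C * vol A.
Proof.
move=> bD; have iD := integrable_norm (bounded_intble _ _ bD).
have bound A : measurable A -> 0 <= \int[mu]_(x in A) `|D x| <= C * vol A.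
  move=> mA; rewrite Rintegral_ge0//= -Rintegral_cst//.
  apply: le_Rintegral => //; [exact: intbleS|exact: finite_measure_integrable_cst|].
  by move=> x _; exact: bD.2.
split=> //; split; last first.
  by exists C => A mA; have /andP[h1 h2] := bound _ mA; rewrite ger0_norm.
move=> A B mA mB AB; rewrite Rintegral_setU//; last by apply/disj_setPS; rewrite AB.
by apply: intbleS => //; exact: measurableU.
Qed.

Lemma not_cvg_far (V : normedModType R) (u : nat -> V) l : ~ (u n @[n --> \oo] --> l) ->
  exists2 e : R, 0 < e & forall N, exists2 n, (N <= n)%N & e <= `|u n - l|.
Proof.
move=> ncv; apply: contrapT => h; apply: ncv; apply/cvgrPdist_lt => e e0.
apply: contrapT => hN; apply: h; exists e => // N; apply: contrapT => hn.
apply: hN; exists N => // n /= Nn; rewrite distrC ltNge; apply/negP => le.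
by apply: hn; exists n.
Qed.

(** The domination, the vanishing and the oscillation of nu are what
    [exact_splitting] requires. Subtracting the ultrafilter limit psi is what
    makes nu tend to 0. *)
Lemma not_completely_continuous_oscillation (X : normedModType R)
    (T : {linear L -> X}) : L1_bounded T -> ~ completely_continuous T ->
  exists U (xs : nat -> {linear X -> R^o}) (psi : {linear L -> R^o}) C delta B,
  let nu n A := (xs n (T (indL1 A)) : R) - psi (indL1 A) in
  [/\ UltraFilter U, forall n, dual_sphere (xs n), L1_bounded psi,
      [/\ forall n, dominated_charge (nu n),
      forall n A, measurable A -> `|nu n A| <= C * vol A,
      forall A, measurable A -> nu n A @[n --> U] --> (0 : R) &
      forall A, measurable A -> A `<=` B -> forall e, 0 < e ->
        \forall n \near U, exists P, [/\ measurable P, P `<=` A &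
          delta * vol A - e <= imbalance (nu n) A P] ] &
      [/\ 0 < delta, Sigma01 B & 0 < vol B]].
Proof.
move=> [M0 TM0] nTcc.
pose M := `|M0| + 1.
have M0' : 0 < M by rewrite /M ltr_wpDl.
have TM f : `|T f| <= M * L1norm f.
  apply: le_trans (TM0 f) _; rewrite ler_wpM2r ?L1norm_ge0//.
  by rewrite /M; have := ler_norm M0; lra.
have [u [f [uf nTuf]]] : exists u f, L1_weak_cvg u f /\ ~ cvgn (T \o u).
  apply: contrapT => h; apply: nTcc => u f uf; apply: contrapT => nc.
  by apply: h; exists u, f.
have nlim : ~ ((T \o u) n @[n --> \oo] --> T f).
  by move=> h; apply: nTuf; apply/cvg_ex; exists (T f).
have [eps eps0 far] := not_cvg_far _ (T \o u) (T f) nlim.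
have /choice[k kP] : forall N, exists n, (N <= n)%N /\ eps <= `|T (u n) - T f|.
  by move=> N; have [n Nn hn] := far N; exists n.
pose g n := u (k n) - f.
have Tg n : eps <= `|T (g n)| by rewrite /g linearB; exact: (kP n).2.
have gw : L1_weak_cvg g 0.
  move=> phi bphi; rewrite linear0; have := uf phi bphi.
  move=> /cvgrPdist_lt h; apply/cvgrPdist_lt => e e0.
  have [N _ hN] := h e e0; exists N => // n /= Nn.
  rewrite sub0r normrN /g linearB distrC; apply: hN => /=.
  exact: leq_trans Nn (kP n).1.
have /choice[xs xsP] : forall n, exists phi : {linear X -> R^o},
    dual_sphere phi /\ phi (T (g n)) = `|T (g n)|.
  move=> n; have Tg0 : T (g n) != 0 by rewrite -normr_gt0; exact: lt_le_trans (Tg n).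
  by have [phi] := dual_sphere_norming _ _ Tg0; exists phi.
have [U [UU FU]] := free_ultrafilter_exists.
have xsT n h : `|xs n (T h)| <= M * L1norm h.
  exact: le_trans (dual_sphere_le _ _ (xsP n).1 _) (TM h).
have [psi [psiP psiC]] := ultralimit_functional U UU (fun n h => xs n (T h)) M
  (fun n a x y => etrans (congr1 (xs n) (linearP T a x y))
     (functional_linear _ (xs n) a (T x) (T y))) xsT.
pose C := 2 * M; have C0 : 0 < C by rewrite mulr_gt0.
have /choice[D DP] : forall n, exists D, bounded_mfun C D /\
    forall h, (xs n (T h) : R) - psi h = pair D h.
  move=> n; have lin a x y : (xs n (T (a *: x + y)) : R) - psi (a *: x + y) =
      a * ((xs n (T x) : R) - psi x) + ((xs n (T y) : R) - psi y).
    by rewrite (linearP T) (functional_linear _ psi) (functional_linear _ (xs n)); ring.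
  have [chi chiE] := linear_bundle L (fun h => (xs n (T h) : R) - psi h) lin.
  have [h|D bD chiD] := functional_density chi C (ltW C0).
    rewrite chiE; apply: le_trans (ler_normB _ _) _.
    by have := xsT n h; have := psiC h; rewrite /C; lra.
  by exists D; split=> // h; rewrite -chiE.
have bD n := (DP n).1; have DE n := (DP n).2.
have [N0 hN0] : exists N0, forall n, (N0 <= n)%N -> eps / 2 <= pair (D n) (g n).
  have := gw psi (ex_intro _ M psiC); rewrite linear0.
  move=> /cvgrPdist_lt /(_ (eps / 2)) [|N _ hN]; first by rewrite divr_gt0.
  exists N => n Nn; rewrite -DE (xsP n).2; have := hN n Nn; rewrite /= sub0r normrN => h.
  by have := Tg n; have := ler_norm (psi (g n)); lra.
have [th th0 [N1 thD]] := dunford_pettis D C g (eps / 2) N0 C0 bD gw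
  ltac:(by rewrite divr_gt0) hN0.
have lamP n := abs_integral_charge C (D n) (bD n).
have /choice[lam lamE] : forall A, exists l : R, measurable A ->
    \int[mu]_(x in A) `|D n x| @[n --> U] --> l.
  move=> A; have [mA|nmA] := pselect (measurable A); last by exists 0.
  have [|l hl] := ultra_bounded_cvg _ UU (fun n => \int[mu]_(x in A) `|D n x|) (C * vol A).
    by move=> n; have /andP[h1 h2] := (lamP n).2 _ mA; rewrite ger0_norm.
  by exists l.
have lamC A : measurable A -> 0 <= lam A <= C * vol A.
  move=> mA; have h := lamE _ mA; have ch : cvg (\int[mu]_(x in A) `|D n x| @[n --> U]).
    by apply/cvg_ex; eexists; exact: h.
  rewrite -(cvg_lim _ h)//; apply/andP; split.
    by apply: limr_ge => //; apply: nearW => n; have /andP[] := (lamP n).2 _ mA.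
  by apply: limr_le => //; apply: nearW => n; have /andP[] := (lamP n).2 _ mA.
have dlam : dominated_charge lam.
  split; last by exists C => A mA; have /andP[h1 h2] := lamC _ mA; rewrite ger0_norm.
  move=> A B mA mB AB; have mAB : measurable (A `|` B) by exact: measurableU.
  rewrite -(cvg_lim _ (lamE _ mAB))//; apply: cvg_lim => //.
  rewrite (_ : (fun n => _) = fun n => \int[mu]_(x in A) `|D n x| + \int[mu]_(x in B) `|D n x|).
    by apply: cvgD; exact: lamE.
  by apply/funext => n; exact: (lamP n).1.1.
have [G bG lamG] := charge_density lam C dlam (ltW C0) (fun A mA =>
  let: conj h1 h2 := andP (lamC A mA) in eq_ind_r (fun x => x <= C * vol A) h2 (ger0_norm h1)).
have lamT : th <= lam setT.
  have h := lamE _ measurableT.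
  rewrite -(cvg_lim _ h)//; apply: limr_ge; first by apply/cvg_ex; eexists; exact: h.
  by apply: FU; exists N1 => // n /= Nn; exact: thD.
pose V := vol (setT : set Om); have V0 : 0 <= V by exact: vol_ge0.
(* Off B0 the density of lam is at most delta, which accounts for at most half
   of the lower bound th for the total mass. *)
pose delta := th / 2 / (V + 1).
have V1 : 0 < V + 1 by lra.
have delta0 : 0 < delta by rewrite !divr_gt0.
pose B0 : set Om := [set x | delta < G x].
have mB0 : measurable B0 by exact: measurable_above bG.1.
have iG := bounded_intble _ _ bG.
have volB0 : 0 < vol B0.
  rewrite lt_neqAle vol_ge0 andbT eq_sym; apply/eqP => B00.
  have : lam (~` B0) <= delta * vol (~` B0).
    rewrite lamG; last exact: measurableC.
    rewrite -Rintegral_cst; last exact: measurableC.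
    have mC : measurable (~` B0) by exact: measurableC.
    apply: le_Rintegral => //; [exact: intbleS|exact: finite_measure_integrable_cst|].
    by move=> x /negP; rewrite -leNgt.
  have := charge_split _ dlam _ _ measurableT mB0; rewrite setTI setTD => E1.
  have /andP[_] := lamC _ mB0; rewrite B00 mulr0 => h1.
  have : delta * vol (~` B0) <= delta * V.
    by rewrite ler_wpM2l ?(ltW delta0)//; apply: le_vol => //; exact: measurableC.
  have : delta * V <= th / 2.
    rewrite /delta mulrAC ler_pdivrMr// ler_wpM2l ?divr_ge0 ?(ltW th0)//; lra.
  lra.
pose B := B0 `&` @unit_itv R.
have mB : measurable B by apply: measurableI => //; exact: measurable_unit_itv.
have volB : vol B = vol B0 by rewrite /vol !mu01E /B -setIA setIid.
have lamB A : measurable A -> A `<=` B -> delta * vol A <= lam A.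
  move=> mA AB; rewrite lamG// -Rintegral_cst//.
  apply: le_Rintegral => //; [exact: finite_measure_integrable_cst|exact: intbleS|].
  by move=> x /AB [/ltW].
have nuE n A : measurable A -> (xs n (T (indL1 A)) : R) - psi (indL1 A) = \int[mu]_(x in A) D n x.
  by move=> mA; rewrite DE (pair_ind _ _ _ (bD n)).
exists U, xs, psi, C, delta, B; split=> //.
- by move=> n; exact: (xsP n).1.
- by exists M.
- split.
  + move=> n; split.
      by move=> A A' mA mA' AA; rewrite indL1U// !linearD /=; ring.
    by exists C => A mA; rewrite DE -L1norm_ind//; exact: pair_bound.
  + by move=> n A mA; rewrite DE -L1norm_ind//; exact: pair_bound.
  + move=> A mA; rewrite -(subrr (psi (indL1 A) : R)).
    by apply: cvgB; [exact: psiP|exact: cvg_cst].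
  + move=> A mA AB e e0; have /cvgrPdist_lt /(_ e e0) := lamE _ mA.
    apply: filterS => n hn.
    have [P [mP PA hP]] := abs_charge C (D n) A (bD n) mA.
    exists P; split=> //; move: hP; rewrite /imbalance !nuE// => ->.
    have := lamB _ mA AB; move: hn; rewrite ltr_norml => /andP[_ h1] h2; lra.
- by split=> //; [split=> // x []|rewrite volB].
Qed.

End oscillation.

(** * One step of the construction *)

Section haar_construction.
Context {R : realType} {X : normedModType R}.
Local Notation Om := (lebesgue_line R).
Local Notation mu := (mu01 R).
Local Notation L := (L1 R).

Lemma dual_sphere_nontrivial (phi : {linear X -> R^o}) : dual_sphere phi ->
  exists x : X, x != 0.
Proof.
move=> [_ phi1]; apply: contrapT => h.
have : (opnorm_on setT phi <= 0)%E.
  apply: ge_ereal_sup => _ [x _ <-].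
  have -> : x = 0 by apply: contrapT => /eqP x0; apply: h; exists x.
  by rewrite linear0 normr0.
by rewrite phi1 lee_fin ler10.
Qed.

Lemma functional_charge (phi : {linear L -> R^o}) : L1_bounded phi ->
  dominated_charge (fun A => phi (indL1 A)).
Proof.
move=> [C phiC]; split; last first.
  by exists C => A mA; rewrite -L1norm_ind//; exact: phiC.
by move=> A B mA mB AB; rewrite indL1U// linearD.
Qed.

Lemma indL1D (A E : set Om) : measurable A -> measurable E -> E `<=` A ->
  indL1 (A `\` E) = indL1 A - indL1 E.
Proof.
move=> mA mE EA; have mAE : measurable (A `\` E) by exact: measurableD.
rewrite -{2}(setDUK EA) indL1U//; first by rewrite addrC addKr.
by rewrite setDE setICA setICr setI0.
Qed.

Lemma imbalance_functional (phi : {linear L -> R^o}) (A E : set Om) :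
  measurable A -> measurable E -> E `<=` A ->
  imbalance (fun B => phi (indL1 B) : R) A E = phi (indL1 E - indL1 (A `\` E)).
Proof.
move=> mA mE EA; rewrite indL1D// opprB addrA -mulr2n linearB linearMn /imbalance.
by rewrite mulr_natl.
Qed.

Section splitting_step.
Variables (T : {linear L -> X}) (T_bounded : L1_bounded T).
Variables (U : set_system nat) (xs : nat -> {linear X -> R^o}).
Variables (psi : {linear L -> R^o}) (C delta : R) (B : set Om).
Let nu n A : R := (xs n (T (indL1 A)) : R) - psi (indL1 A).
Hypotheses (UU : UltraFilter U) (xs_sphere : forall n, dual_sphere (xs n)).
Hypothesis psi_bounded : L1_bounded psi.
Hypothesis nu_dom : forall n, dominated_charge (nu n).
Hypothesis nu_le : forall n A, measurable A -> `|nu n A| <= C * vol A.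
Hypothesis nu_cvg0 : forall A, measurable A -> nu n A @[n --> U] --> 0.
Hypothesis delta0 : 0 < delta.
Hypothesis nu_oscillates : forall A, measurable A -> A `<=` B -> forall e, 0 < e ->
  \forall n \near U, exists P, [/\ measurable P, P `<=` A &
    delta * vol A - e <= imbalance (nu n) A P].

(** All the sets of a level are split with the same functional xs n: each of them
    excludes only a set of indices n that is negligible for U. *)
Lemma splitting_step (F : nat -> set Om) (N : nat) (tau : R) : 1 < tau ->
  (forall k, (0 < k <= N)%N -> [/\ measurable (F k), F k `<=` B & 0 < vol (F k)]) ->
  exists (x : {linear X -> R^o}) p (y : 'I_p -> {linear X -> R^o}) (F' : nat -> set Om),
  [/\ dual_sphere x, forall i, dual_sphere (y i),
      norms_within (range y)
        (lin_span [set T (indL1 (F k)) | k in [set k | (0 < k <= N)%N]]) tau &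
      forall k, (0 < k <= N)%N ->
      [/\ measurable (F' (2 * k).-1) /\ measurable (F' (2 * k)%N),
          F k = F' (2 * k).-1 `|` F' (2 * k)%N /\ F' (2 * k).-1 `&` F' (2 * k)%N = set0,
          vol (F' (2 * k).-1) = vol (F k) / 2 /\ vol (F' (2 * k)%N) = vol (F k) / 2,
          delta / 4 * vol (F k) <= x (T (indL1 (F' (2 * k).-1) - indL1 (F' (2 * k)%N))) &
          forall i, y i (T (indL1 (F' (2 * k).-1) - indL1 (F' (2 * k)%N))) = 0]].
Proof.
move=> tau1 FP; have [x0 x00] := dual_sphere_nontrivial _ (xs_sphere 0%N).
have spanE : fin_dim_subspace
    (lin_span [set T (indL1 (F k)) | k in [set k | (0 < k <= N)%N]]).
  exists N, (fun i : 'I_N => T (indL1 (F i.+1))); congr lin_span.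
  apply/seteqP; split=> z.
    by move=> [[//|k] /= kN <-]; exists (Ordinal kN).
  by move=> [i _ <-]; exists i.+1 => //=; exact: ltn_ord.
have [p [y [ysph ynorm]]] := fin_dim_norming _ _ tau x0 x00 tau1 spanE.
have Tfun (phi : {linear X -> R^o}) : dual_sphere phi ->
    exists2 chi : {linear L -> R^o}, L1_bounded chi & forall f, chi f = phi (T f).
  move=> phis; have lin a f g : phi (T (a *: f + g)) = a * phi (T f) + phi (T g) :> R.
    by rewrite (linearP T) functional_linear.
  have [chi chiE] := linear_bundle L (fun f => phi (T f) : R) lin.
  have [M TM] := T_bounded; exists chi => //; exists M => f; rewrite chiE.
  exact: le_trans (dual_sphere_le _ _ phis _) (TM f).
have /choice[ychi ychiP] : forall i, exists chi : {linear L -> R^o},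
    L1_bounded chi /\ forall f, chi f = y i (T f).
  by move=> i; have [chi] := Tfun _ (ysph i); exists chi.
(* Exactness for vol gives halves of equal measure, and exactness for psi makes
   the imbalances of nu n and of xs n o T equal. *)
pose ms i : set Om -> R :=
  if i is j.+2 then (if insub j is Some l then (fun A => ychi l (indL1 A)) else vol)
  else if i is 1%N then (fun A => psi (indL1 A)) else vol.
have ms_dom i : dominated_charge (ms i).
  case: i => [|[|j]] /=; [exact: vol_dominated|exact: functional_charge|].
  case: insub => [l|]; last exact: vol_dominated.
  exact: functional_charge (ychiP l).1.
have near_split : \forall n \near U, forall k, (k < N)%N ->
    exists E, [/\ measurable E, E `<=` F k.+1,
      forall i, (i < p.+2)%N -> imbalance (ms i) (F k.+1) E = 0 &
      delta / 4 * vol (F k.+1) <= imbalance (nu n) (F k.+1) E].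
  apply: near_forall_lt => k kN; have [mF FB F0] := FP k.+1 kN.
  exact: (exact_splitting U UU nu C delta B nu_dom nu_le nu_cvg0 delta0 nu_oscillates
    ms p.+2 (F k.+1) ms_dom mF FB F0).
have [n nP] := @filter_ex _ U _ _ near_split.
have /choice[E EP] : forall k, exists E, (0 < k <= N)%N ->
    [/\ measurable E, E `<=` F k,
      forall i, (i < p.+2)%N -> imbalance (ms i) (F k) E = 0 &
      delta / 4 * vol (F k) <= imbalance (nu n) (F k) E].
  case=> [|k]; first by exists set0.
  have [kN|nkN] := boolP (k < N)%N; last by exists set0.
  by have [E EP] := nP k kN; exists E.
(* The children of F k are numbered 2 k - 1 and 2 k, and both numbers have k as
   upper half. *)
pose F' j := if odd j then E (uphalf j) else F (uphalf j) `\` E (uphalf j).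
have F'odd k : (0 < k)%N -> F' (2 * k).-1 = E k.
  case: k => // k _; rewrite /F' mul2n doubleS /= odd_double /=.
  by rewrite ?doubleK ?uphalf_double.
have F'even k : F' (2 * k)%N = F k `\` E k.
  by rewrite /F' mul2n odd_double uphalf_double.
exists (xs n), p, y, F'; split=> // k kN.
have [mF FB F0] := FP k kN; have [mE EF E0 Enu] := EP k kN.
have k0 : (0 < k)%N by case/andP: kN.
have mFE : measurable (F k `\` E k) by exact: measurableD.
have Evol : vol (E k) = vol (F k) / 2 by have := E0 0%N isT; rewrite /ms /imbalance; lra.
have Epsi : psi (indL1 (E k) - indL1 (F k `\` E k)) = 0.
  by rewrite -imbalance_functional//; exact: (E0 1%N).
rewrite F'odd// F'even; split=> //.
- split; first by rewrite setDUK.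
  by rewrite setDE setICA setICr setI0.
- split=> //; rewrite (charge_diff _ vol_dominated)// Evol; lra.
- have [chi chib chiE] := Tfun _ (xs_sphere n).
  apply: le_trans Enu _.
  have -> : imbalance (nu n) (F k) (E k) =
      imbalance (fun A => chi (indL1 A) : R) (F k) (E k) -
      imbalance (fun A => psi (indL1 A) : R) (F k) (E k).
    by rewrite /imbalance /nu !chiE; ring.
  by rewrite !imbalance_functional// Epsi subr0 chiE.
- move=> i; rewrite -(ychiP i).2 -imbalance_functional//.
  have := E0 i.+2; rewrite /ms /= !ltnS ltn_ord => /(_ isT).
  by case: insubP => [l _ /val_inj -> //|]; rewrite ltn_ord.
Qed.

End splitting_step.

Section haar_system_construction.
Variables (A : nat -> nat -> set Om).
Let V : R := fine (mu (A 0%N 1%N)).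

(** For 2 ^ n < j <= 2 ^ (n + 1), the logarithm of j - 1 recovers n. *)
Definition haar_of (j : nat) : L :=
  if (j <= 1)%N then V^-1 *: indL1 (A 0%N 1%N) else
  let n := trunc_log 2 j.-1 in let k := (j - 2 ^ n)%N in
  (2 ^+ n / V) *: (indL1 (A n.+1 (2 * k).-1) - indL1 (A n.+1 (2 * k)%N)).

Lemma haar_ofE n k : (0 < k <= 2 ^ n)%N -> haar_of (2 ^ n + k) =
  (2 ^+ n / V) *: (indL1 (A n.+1 (2 * k).-1) - indL1 (A n.+1 (2 * k)%N)).
Proof.
move=> /andP[k0 kn]; rewrite /haar_of.
have p0 : (0 < 2 ^ n)%N by rewrite expn_gt0.
have -> : (2 ^ n + k <= 1)%N = false.
  by apply/negbTE; rewrite -ltnNge; rewrite -(addn1 1) leq_add.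
have -> : trunc_log 2 (2 ^ n + k).-1 = n.
  apply: trunc_log_eq => //; case: k k0 kn => // k _ kn.
  by rewrite addnS /= leq_addr expnS mul2n -addnn ltn_add2l.
by rewrite /= addKn.
Qed.

Lemma haar_of_system : (forall n k, (0 < k <= 2 ^ n)%N -> measurable (A n k)) ->
  haar_system A haar_of.
Proof.
move=> mA; split=> [x|n k kn x].
  by rewrite /haar_of /= -[LHS]/(V^-1 * indL1 (A 0%N 1%N) x) indL1E//; exact: mA.
have /andP[k0 k2] := kn.
have m1 : measurable (A n.+1 (2 * k).-1).
  apply: mA; rewrite expnS; case: k k0 k2 {kn} => // k _ k2.
  by rewrite mulnS /=; apply: leq_trans (leq_mul (leqnn 2) k2); rewrite mulnS.
have m2 : measurable (A n.+1 (2 * k)%N).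
  by apply: mA; rewrite expnS muln_gt0 k0 leq_mul2l.
rewrite haar_ofE// -[LHS]/(2 ^+ n / V *
  (indL1 (A n.+1 (2 * k).-1) x - indL1 (A n.+1 (2 * k)%N) x)).
by rewrite !indL1E.
Qed.

End haar_system_construction.
End haar_construction.

(** * The dyadic recursion *)

Section haar_blocks.
Context {R : realType} {X : normedModType R}.
Local Notation Om := (lebesgue_line R).

Lemma dyadic_index n k : (0 < k <= 2 ^ n.+1)%N ->
  exists2 l, (0 < l <= 2 ^ n)%N & k = (2 * l).-1 \/ k = (2 * l)%N.
Proof.
move=> /andP[k0 kn]; exists (uphalf k).
  rewrite uphalf_gt0 k0 /= leq_uphalf_double; by rewrite -mul2n -expnS.
have := odd_double_half k; rewrite uphalf_half mul2n.
by move: (odd k) (k./2) => [] m <-; [left; rewrite add1n doubleS|right].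
Qed.

(** This lets the norming sets at level n be chosen from the sets of level n alone,
    without reference to the earlier levels. *)
Lemma haar_span (T : {linear L1 R -> X}) (A : nat -> nat -> set Om) n :
  (forall n k, (0 < k <= 2 ^ n)%N -> measurable (A n k)) ->
  (forall n k, (0 < k <= 2 ^ n)%N ->
     A n k = A n.+1 (2 * k).-1%N `|` A n.+1 (2 * k)%N /\
     A n.+1 (2 * k).-1%N `&` A n.+1 (2 * k)%N = set0) ->
  lin_span [set T (haar_of A j) | j in [set j | (0 < j <= 2 ^ n)%N]] `<=`
  lin_span [set T (indL1 (A n k)) | k in [set k | (0 < k <= 2 ^ n)%N]].
Proof.
move=> mA splitA; apply: lin_span_mono => _ [j /= jn <-].
elim: n j jn => [|n IH] j jn.
  have -> : j = 1%N by case: j jn => [|[|]].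
  by rewrite /haar_of /= linearZ; apply/lin_spanZ/lin_span_gen; exists 1%N.
have child k : (0 < k <= 2 ^ n)%N -> (0 < (2 * k).-1 <= 2 ^ n.+1)%N /\
    (0 < 2 * k <= 2 ^ n.+1)%N.
  case: k => // k kn; have {}kn : (k < 2 ^ n)%N := kn; rewrite expnS leq_mul2l kn; split=> //.
  have -> : (2 * k.+1).-1 = (2 * k).+1 by rewrite mulnS.
  by rewrite ltnS leq0n /=; apply: leq_trans (leq_mul (leqnn 2) kn); rewrite mulnS.
have [jle|jgt] := leqP j (2 ^ n).
  have := IH j; rewrite jle andbT; have -> : (0 < j)%N by case/andP: jn.
  move=> /(_ isT); apply: lin_span_mono => _ [k /= kn <-].
  have [AE A0] := splitA n k kn; have [c1 c2] := child _ kn.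
  rewrite AE indL1U//; [rewrite linearD|exact: mA|exact: mA].
  by apply: lin_spanD; apply: lin_span_gen; [exists (2 * k).-1|exists (2 * k)%N].
have /andP[_ jn2] := jn.
have kn : (0 < j - 2 ^ n <= 2 ^ n)%N.
  by rewrite subn_gt0 jgt leq_subLR addnn -mul2n -expnS.
have [c1 c2] := child _ kn.
rewrite -(subnKC (ltnW jgt)) haar_ofE// linearZ linearB; apply: lin_spanZ.
rewrite -scaleN1r addrC; apply: lin_span_linear; apply: lin_span_gen.
  by exists (2 * (j - 2 ^ n))%N.
by exists (2 * (j - 2 ^ n)).-1.
Qed.

Lemma haar_blocks_exist (T : {linear L1 R -> X}) (tau : nat -> R) :
  L1_bounded T -> ~ completely_continuous T -> (forall n, 1 < tau n) ->
  exists (A : nat -> nat -> set Om) (h : nat -> L1 R)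
      (xs : nat -> {linear X -> R^o})
      (p : nat -> nat) (y : forall n, 'I_(p n) -> {linear X -> R^o}),
    [/\ dyadic_splitting A,
        haar_system A h,
        forall n, dual_sphere (xs n),
        forall n (i : 'I_(p n)), dual_sphere (y n i) &
        exists2 delta : R, 0 < delta &
          forall n,
          [/\ forall k, (0 < k <= 2 ^ n)%N ->
                delta < xs n (T (h (2 ^ n + k)%N)),
              norms_within (range (y n))
                (lin_span [set T (h j) | j in [set j | (0 < j <= 2 ^ n)%N]])
                (tau n) &
              forall k (i : 'I_(p n)), (0 < k <= 2 ^ n)%N ->
                y n i (T (h (2 ^ n + k)%N)) = 0]].
Proof.
move=> Tb nTcc tau1.
have [U [xs [psi [C [delta [B [UU xsph psib [nud nul nu0 nuv] [d0 BS B0]]]]]]]] :=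
  not_completely_continuous_oscillation _ T Tb nTcc.
pose I n (F : nat -> set Om) := forall k, (0 < k <= 2 ^ n)%N ->
  [/\ measurable (F k), F k `<=` B & 0 < vol (F k)].
pose data := ({linear X -> R^o} * {p : nat & 'I_p -> {linear X -> R^o}} *
  (nat -> set Om))%type.
pose good n (F : nat -> set Om) (d : data) := [/\ dual_sphere d.1.1,
  forall i, dual_sphere (projT2 d.1.2 i),
  norms_within (range (projT2 d.1.2))
        (lin_span [set T (indL1 (F k)) | k in [set k | (0 < k <= 2 ^ n)%N]]) (tau n) &
      forall k, (0 < k <= 2 ^ n)%N ->
      [/\ measurable (d.2 (2 * k).-1) /\ measurable (d.2 (2 * k)%N),
          F k = d.2 (2 * k).-1 `|` d.2 (2 * k)%N /\
            d.2 (2 * k).-1 `&` d.2 (2 * k)%N = set0,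
          vol (d.2 (2 * k).-1) = vol (F k) / 2 /\ vol (d.2 (2 * k)%N) = vol (F k) / 2,
          delta / 4 * vol (F k) <=
            d.1.1 (T (indL1 (d.2 (2 * k).-1) - indL1 (d.2 (2 * k)%N))) &
          forall i, projT2 d.1.2 i
            (T (indL1 (d.2 (2 * k).-1) - indL1 (d.2 (2 * k)%N))) = 0]].
have /choice[next nextP] : forall nF : nat * (nat -> set Om), exists d : data,
    I nF.1 nF.2 -> good nF.1 nF.2 d.
  move=> [n F]; have [IF|nIF] := pselect (I n F); last first.
    by exists (xs 0%N, existT _ 0%N (fun=> xs 0%N), F).
  have [x [p [y [F' [h1 h2 h3 h4]]]]] := splitting_step T Tb U xs psi C delta B UU
    xsph psib nud nul nu0 d0 nuv F (2 ^ n) (tau n) (tau1 n) IF.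
  by exists (x, existT _ p y, F') => _; split.
pose fix A n := if n is n'.+1 then (next (n', A n')).2 else (fun=> B).
pose D n := next (n, A n).
have AS n : A n.+1 = (D n).2 by [].
have IA n : I n (A n).
  elim: n => [|n IH]; first by move=> k _; split=> //; exact: BS.1.
  have [_ _ _ h] : good n (A n) (D n) := nextP (n, A n) IH.
  move=> k /dyadic_index[l ln kl]; have [[m1 m2] [AE _] [v1 v2] _ _] := h l ln.
  have [_ FB F0] := IH l ln.
  rewrite AS; case: kl => ->; split; rewrite ?v1 ?v2 ?divr_gt0//.
    by move=> x Ax; apply: FB; rewrite AE; left.
  by move=> x Ax; apply: FB; rewrite AE; right.
have good_D n : good n (A n) (D n) := nextP (n, A n) (IA n).
have mA n k : (0 < k <= 2 ^ n)%N -> measurable (A n k) by move=> /IA[].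
have splitA n k : (0 < k <= 2 ^ n)%N ->
     A n k = A n.+1 (2 * k).-1%N `|` A n.+1 (2 * k)%N /\
     A n.+1 (2 * k).-1%N `&` A n.+1 (2 * k)%N = set0.
  by move=> kn; have [_ _ _ /(_ k kn)[]] := good_D n.
have volA n k : (0 < k <= 2 ^ n)%N -> vol (A n k) = vol B / 2 ^+ n.
  elim: n k => [|n IH] k; first by rewrite expr0 divr1.
  move=> /dyadic_index[l ln kl]; have [_ _ _ /(_ l ln)[_ _ [v1 v2] _ _]] := good_D n.
  have -> : vol (A n.+1 k) = vol (A n l) / 2 by rewrite AS; case: kl => ->.
  by rewrite IH// exprSr invfM mulrA.
exists A, (haar_of A), (fun n => (D n).1.1), (fun n => projT1 (D n).1.2),
  (fun n => projT2 (D n).1.2); split.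
- split.
  + by move=> n k kn; have [mAk AB _] := IA n k kn; split=> //; exact: subset_trans AB BS.2.
  + by rewrite -volE ?lte_fin//; exact: BS.1.
  + move=> n k kn; have [AE A0] := splitA n k kn; split=> //.
    have [_ _ _ /(_ k kn)[[m1 m2] _ [v1 v2] _ _]] := good_D n.
    by rewrite -(volE _ m1) -(volE _ m2) v1 v2.
- exact: haar_of_system.
- by move=> n; have [] := good_D n.
- by move=> n; have [] := good_D n.
exists (delta / 8); first by rewrite divr_gt0.
move=> n; have [_ _ ynorm hD] := good_D n; split.
- move=> k kn; have [_ _ _ h _] := hD k kn.
  rewrite haar_ofE// linearZ linearZ -/(vol (A 0%N 1%N)) (volA 0%N 1%N)//.
  rewrite expr0 divr1; move: h; rewrite volA//=.
  set z := (X in _ <= X) => h.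
  have p0 : 0 < 2 ^+ n / vol B by rewrite divr_gt0// exprn_gt0.
  apply: (@lt_le_trans _ _ (2 ^+ n / vol B * (delta / 4 * (vol B / 2 ^+ n)))).
    rewrite [ltRHS](_ : _ = delta / 4); first lra.
    by field; rewrite ?expf_neq0// ?gt_eqF.
  by rewrite ler_pM2l.
- move=> v Sv; apply: ynorm; exact: haar_span Sv.
- move=> k i kn; have [_ _ _ _ h] := hD k kn.
  by rewrite haar_ofE// !linearZ /= h scaler0.
Qed.

End haar_blocks.

Theorem theorem1 (R : realType) (X : completeNormedModType R)
    (T : {linear L1 R -> X}) (tau : nat -> R)
    (T_bounded : L1_bounded T)
    (T_not_cc : ~ completely_continuous T)
    (tau_gt1 : forall n, 1 < tau n) :
  (exists (A : nat -> nat -> set (lebesgue_line R)) (h : nat -> L1 R)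
      (xs : nat -> {linear X -> R^o})
      (p : nat -> nat) (y : forall n, 'I_(p n) -> {linear X -> R^o}),
    [/\ dyadic_splitting A,
        haar_system A h,
        forall n, dual_sphere (xs n),
        forall n (i : 'I_(p n)), dual_sphere (y n i) &
        exists2 delta : R, 0 < delta &
          forall n,
          [/\ forall k, (0 < k <= 2 ^ n)%N ->
                delta < xs n (T (h (2 ^ n + k)%N)),
              norms_within (range (y n))
                (lin_span [set T (h j) | j in [set j | (0 < j <= 2 ^ n)%N]])
                (tau n) &
              forall k (i : 'I_(p n)), (0 < k <= 2 ^ n)%N ->
                y n i (T (h (2 ^ n + k)%N)) = 0]])
  /\
  (cvgn (fun N => \prod_(0 <= n < N) tau n) ->
   forall (A : nat -> nat -> set (lebesgue_line R)) (h : nat -> L1 R)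
      (p : nat -> nat) (y : forall n, 'I_(p n) -> {linear X -> R^o}),
    dyadic_splitting A ->
    haar_system A h ->
    (forall n (i : 'I_(p n)), dual_sphere (y n i)) ->
    (forall n,
       norms_within (range (y n))
         (lin_span [set T (h j) | j in [set j | (0 < j <= 2 ^ n)%N]])
         (tau n)) ->
    (forall n k (i : 'I_(p n)), (0 < k <= 2 ^ n)%N ->
       y n i (T (h (2 ^ n + k)%N)) = 0) ->
    let E := dyadic_block (fun j => T (h j)) in
    let Y := closed_lin_span (\bigcup_n E n) in
    is_fdd Y E /\
    (fdd_constant Y E <= (limn (fun N => \prod_(0 <= n < N) tau n))%:E)%E).
Proof.
split; first exact: haar_blocks_exist.
move=> cvtau A h p y _ _ ysph ynorm yvan.
exact: (norming_blocks_fdd _ (fun j => T (h j)) tau p y tau_gt1 cvtau ysph ynorm yvan).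
Qed.
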